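(* Let $p>2$ be a prime, $\mathbf{F}$ a field of characteristic $p$, $M=(c_{ij})\in\mathbf{F}^{2\times3}$, and let $V_M$ be the associated three-dimensional representation of $G=(\mathbf{Z}/p)^3=\langle e_1,e_2,e_3\rangle$, so that $G$ acts on $\mathbf{F}[V_M]=\mathbf{F}[x,y,z]$ by algebra automorphisms with $x\cdot e_i=x$, $y\cdot e_i=y+c_{1i}x$, $z\cdot e_i=z+2c_{1i}y+(c_{1i}^2+c_{2i})x$ for $i=1,2,3$. Let $\overline\gamma_{ijk}$, $\overline f_1,\overline f_2,\overline f_3$, $N_G(z)$ be as defined in the context. If $\overline\gamma_{123}\ne0$ and $\overline\gamma_{135}\neq0$, then $\{x,\overline f_1,\overline f_2,\overline f_3,N_G(z)\}$ is a SAGBI basis for $\mathbf{F}[V_M]^G$ with respect to the graded reverse lexicographic order with $x<y<z$. Furthermore, there are two relations among the generators, one constructed by subducting $\overline f_3^{\,p}+\overline\gamma_{135}^{\,p}\,\overline\gamma_{123}^{\,p^2-2p-1}\,\overline f_1\overline f_2^{\,p}$ and the other given by $$\overline f_1^{\,p}+\overline\gamma_{123}^{\,p-2}\overline f_2^{\,2}+2(-\overline\gamma_{123})^{(p-3)/2}\,\overline\gamma_{125}x^{p^2-p}\overline f_1^{\,(p+1)/2}+2x^{p^2-2}\overline f_3=0.$$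
   Context: Let $\delta=y^2-xz$. Let $\overline\gamma_{ijk}\in\mathbf{F}$ be the $3\times3$ minor, on rows $i<j<k$, of the matrix whose rows $1,\ldots,5$ are $(c_{11},c_{12},c_{13})$, $(c_{21},c_{22},c_{23})$, $(c_{11}^p,c_{12}^p,c_{13}^p)$, $(c_{21}^p,c_{22}^p,c_{23}^p)$, $(c_{11}^{p^2},c_{12}^{p^2},c_{13}^{p^2})$. Define $$\overline f_1=-\overline\gamma_{123}\delta^p-\overline\gamma_{124}x^py^p-\overline\gamma_{134}\delta x^{2p-2}-\overline\gamma_{234}yx^{2p-1},$$ $$\overline f_2=\overline\gamma_{123}y^{p^2}-\overline\gamma_{125}y^px^{p^2-p}-\overline\gamma_{135}\delta x^{p^2-2}-\overline\gamma_{235}yx^{p^2-1},$$ $$\overline f_3=\frac{\overline f_1^{\,p}+\overline\gamma_{123}^{\,p-2}\overline f_2^{\,2}+2(-\overline\gamma_{123})^{(p-3)/2}\,\overline\gamma_{125}x^{p^2-p}\overline f_1^{\,(p+1)/2}}{-2x^{p^2-2}},$$ where $\overline f_3$ is a polynomial; all three are $G$-invariant. $N_G(z)$ is the product of the elements of the $G$-orbit of $z$. A subset $\mathcal{B}$ of a subalgebra $A$ of a polynomial ring is a SAGBI basis for $A$ if the lead monomials of the elements of $\mathcal{B}$ generate, as an algebra, the lead term algebra of $A$ (the algebra spanned by the lead monomials of nonzero elements of $A$); then $\mathcal{B}$ generates $A$. To subduct a polynomial $F$ over $\mathcal{B}$ is to repeatedly subtract from it scalar multiples of products of elements of $\mathcal{B}$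 having the same lead term as the current polynomial; for a SAGBI basis, every $F\in A$ subducts to $0$. If $F$ is a polynomial expression in elements of $\mathcal{B}$, its subduction to $0$ yields an identity $F-\sum_I c_I\,b^I=0$ with products $b^I$ of elements of $\mathcal{B}$: this is the relation constructed by subducting $F$. ''There are two relations'' means that the ideal of all algebraic relations among the listed generators is generated by those two relations. *)

(* Defs.v *)
From mathcomp Require Import all_boot all_order all_algebra.
From mathcomp Require Export mpoly.

Set Implicit Arguments.
Unset Strict Implicit.
Unset Printing Implicit Defensive.

Import GRing.Theory.
Local Open Scope ring_scope.

(* Graded reverse lexicographic order with 'X_0 < 'X_1 < ... : among monomials
   of the same degree, the smaller one has the larger exponent at the smallest
   variable where they differ.  The order that the multinomials library puts on
   'X_{1..n} (and hence mlead) breaks ties lexicographically, which is a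
   different order for n > 2, whatever the numbering of the variables. *)
Definition grevlex_lt n (m1 m2 : 'X_{1..n}) : bool :=
  (mdeg m1 < mdeg m2)%N ||
  (mdeg m1 == mdeg m2) &&
    [exists i : 'I_n, (m2 i < m1 i)%N &&
      [forall j : 'I_n, (j < i)%N ==> (m1 j == m2 j)]].

Definition grevlex_max n (m1 m2 : 'X_{1..n}) : 'X_{1..n} :=
  if grevlex_lt m1 m2 then m2 else m1.

Section LeadTerms.
Variables (F : fieldType) (n : nat).
Implicit Types (q : {mpoly F[n]}) (A : {mpoly F[n]} -> Prop).

(* The lead monomial of 0 is 0%MM by convention. *)
Definition lead_mon q : 'X_{1..n} :=
  \big[@grevlex_max n/0%MM]_(m <- msupp q) m.

Definition lead_term q : {mpoly F[n]} := q@_(lead_mon q) *: 'X_[lead_mon q].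

(* The span of the lead monomials of the nonzero elements of A. *)
Definition lead_term_algebra A q : Prop :=
  exists s : seq (F * {mpoly F[n]}),
    (forall u, u \in s -> A u.2 /\ u.2 != 0) /\
    q = \sum_(u <- s) u.1 *: 'X_[lead_mon u.2].

Definition generated_algebra k (b : k.-tuple {mpoly F[n]}) q : Prop :=
  exists P : {mpoly F[k]}, q = P \mPo b.

(* A zero entry of b would contribute the monomial 'X_[0] = 1, which lies in
   every algebra. *)
Definition sagbi_basis A k (b : k.-tuple {mpoly F[n]}) : Prop :=
  (forall i, A (tnth b i)) /\
  forall q, generated_algebra [tuple 'X_[lead_mon (tnth b i)] | i < k] q
            <-> lead_term_algebra A q.

(* subducts_to0 b q P : some sequence of subduction steps over b takes q to 0,
   and P collects the formal expressions of what was subtracted, so that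
   q = P \mPo b.  Note that 'X_[I] \mPo b is the product of the
   tnth b i ^+ I i. *)
Inductive subducts_to0 k (b : k.-tuple {mpoly F[n]}) :
    {mpoly F[n]} -> {mpoly F[k]} -> Prop :=
| SubductsDone : subducts_to0 b 0 0
| SubductsStep q (a : F) (I : 'X_{1..k}) P :
    q != 0 ->
    lead_term (a *: ('X_[I] \mPo b)) = lead_term q ->
    subducts_to0 b (q - a *: ('X_[I] \mPo b)) P ->
    subducts_to0 b q (a *: 'X_[I] + P).

Definition relations_generated_by k (b : k.-tuple {mpoly F[n]})
    (r1 r2 : {mpoly F[k]}) : Prop :=
  forall Q : {mpoly F[k]},
    Q \mPo b = 0 <-> exists Q1 Q2, Q = Q1 * r1 + Q2 * r2.

(* The quotient of q by 'X_[m], discarding the monomials that 'X_[m] does not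
   divide; it is the exact quotient whenever there is one (monom_quoK). *)
Definition monom_quo (m : 'X_{1..n}) q : {mpoly F[n]} :=
  \sum_(m' <- msupp q | (m <= m')%MM) q@_m' *: 'X_[m' - m].

Lemma monom_quoK (m : 'X_{1..n}) q : monom_quo m ('X_[m] * q) = q.
Proof.
rewrite /monom_quo mulrC (perm_big _ (msuppMX q m)) /= big_map.
rewrite [RHS]mpolyE; under eq_bigl do rewrite lem_addr //.
by apply: eq_bigr => i _; rewrite mcoeffMX addmC addmK.
Qed.

End LeadTerms.

Section Representation.
Variables (p : nat) (F : fieldType) (c : 'M[F]_(2, 3)).

Local Notation x := ('X_(inord 0) : {mpoly F[3]}).
Local Notation y := ('X_(inord 1) : {mpoly F[3]}).
Local Notation z := ('X_(inord 2) : {mpoly F[3]}).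

Definition gen_act (i : 'I_3) (q : {mpoly F[3]}) : {mpoly F[3]} :=
  q \mPo [tuple x;
                y + c 0 i *: x;
                z + (2 * c 0 i) *: y + (c 0 i ^+ 2 + c 1 i) *: x].

(* The right action of e_1^(g_1) e_2^(g_2) e_3^(g_3), for g in (Z/p)^3. *)
Definition group_act (g : 'rV['Z_p]_3) (q : {mpoly F[3]}) : {mpoly F[3]} :=
  let e i := iter (g 0 (inord i)) (gen_act (inord i)) in
  e 2%N (e 1%N (e 0%N q)).

Definition G_invariant (q : {mpoly F[3]}) : Prop :=
  forall g : 'rV['Z_p]_3, group_act g q = q.

Definition orbit_product (q : {mpoly F[3]}) : {mpoly F[3]} :=
  \prod_(q' <- undup (codom (fun g : 'rV['Z_p]_3 => group_act g q))) q'.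

Definition Gamma : 'M[F]_(5, 3) :=
  \matrix_(r < 5, j < 3)
    nth 0 [:: c 0 j; c 1 j; c 0 j ^+ p; c 1 j ^+ p; c 0 j ^+ (p ^ 2)] r.

(* The row indices i, j, k are counted from 1. *)
Definition gamma (i j k : nat) : F :=
  \det (rowsub (tnth [tuple inord i.-1; inord j.-1; inord k.-1]) Gamma).

Definition delta : {mpoly F[3]} := y ^+ 2 - x * z.

Definition f1 : {mpoly F[3]} :=
  - (gamma 1 2 3 *: delta ^+ p)
  - gamma 1 2 4 *: (x ^+ p * y ^+ p)
  - gamma 1 3 4 *: (delta * x ^+ (2 * p - 2))
  - gamma 2 3 4 *: (y * x ^+ (2 * p - 1)).

Definition f2 : {mpoly F[3]} :=
  gamma 1 2 3 *: y ^+ (p ^ 2)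
  - gamma 1 2 5 *: (y ^+ p * x ^+ (p ^ 2 - p))
  - gamma 1 3 5 *: (delta * x ^+ (p ^ 2 - 2))
  - gamma 2 3 5 *: (y * x ^+ (p ^ 2 - 1)).

Definition f3_numerator : {mpoly F[3]} :=
  f1 ^+ p
  + gamma 1 2 3 ^+ (p - 2) *: f2 ^+ 2
  + (2 * (- gamma 1 2 3) ^+ ((p - 3) %/ 2) * gamma 1 2 5) *:
      (x ^+ (p ^ 2 - p) * f1 ^+ ((p + 1) %/ 2)).

Definition f3 : {mpoly F[3]} :=
  (- 2)^-1 *: monom_quo (U_(inord 0) *+ (p ^ 2 - 2))%MM f3_numerator.

Definition generators : 5.-tuple {mpoly F[3]} :=
  [tuple x; f1; f2; f3; orbit_product z].

(* In the polynomials below, the variables 'X_0, ..., 'X_4 stand for the five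
   generators, in the order in which they are listed. *)
Local Notation T i := ('X_(inord i) : {mpoly F[5]}).

Definition subducted_expression : {mpoly F[5]} :=
  T 3 ^+ p
  + (gamma 1 3 5 ^+ p * gamma 1 2 3 ^+ (p ^ 2 - 2 * p - 1)) *:
      (T 1 * T 2 ^+ p).

Definition second_relation : {mpoly F[5]} :=
  T 1 ^+ p
  + gamma 1 2 3 ^+ (p - 2) *: T 2 ^+ 2
  + (2 * (- gamma 1 2 3) ^+ ((p - 3) %/ 2) * gamma 1 2 5) *:
      (T 0 ^+ (p ^ 2 - p) * T 1 ^+ ((p + 1) %/ 2))
  + 2 *: (T 0 ^+ (p ^ 2 - 2) * T 3).

End Representation.

(* Main.v *)
Require Import Defs.
From mathcomp Require Import all_boot all_order all_algebra.
From mathcomp Require Import mpoly.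
From HB Require Import structures.
From mathcomp Require Import ring zify.

Set Implicit Arguments.
Unset Strict Implicit.
Unset Printing Implicit Defensive.

Import GRing.Theory.
Local Open Scope ring_scope.

(* Put Y = y/x and s = f2/x^(p^2).  Since gamma 1 3 5 <> 0, delta occurs linearly
   in f2, so F[x, 1/x, y, z] = F[x, 1/x, s][Y].  Here x and s are invariant, and
   the elements of G translate Y by p^3 distinct constants (gamma 1 3 5 <> 0
   again).  Hence the invariants are the polynomials in phi1 = f1/x^(2p), which
   has degree p^3 in Y and a constant lead coefficient.  Up to powers of x, f3 and
   N_G(z) are polynomials in phi1 of degrees p and p^2 with constant lead
   coefficients; so every invariant becomes, after multiplication by a power of
   x, a combination of the normal monomials x^e f1^i f2^j f3^k N_G(z)^l with
   i, k < p.  Their lead monomials x^e y^(2pi + p^2 j + (p^2+2)k) z^(p^3 l) are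
   pairwise distinct.  Therefore a combination divisible by x is divisible by x
   term by term, and the power of x cancels; this gives the SAGBI property, and
   peeling off normal monomials is a subduction.  Finally, the two relations
   rewrite f1^p and f3^p, bringing any polynomial in the generators to a normal
   form, which vanishes if its value does.  The polynomial P collected by a
   subduction cannot spoil this, because all its monomials involve x. *)

(** * The graded reverse lexicographic order *)

Section Grevlex.
Variable n : nat.
Implicit Types m : 'X_{1..n}.

Lemma grevlex_ltP m1 m2 :
  reflect ((mdeg m1 < mdeg m2)%N \/
           mdeg m1 = mdeg m2 /\
           exists2 i : 'I_n, (m2 i < m1 i)%N & forall j : 'I_n, (j < i)%N -> m1 j = m2 j)
          (grevlex_lt m1 m2).
Proof.
apply: (iffP orP) => -[lt|].
- by left.
- case/andP=> /eqP-> /existsP[i /andP[lti /forallP eqi]]; right; split=> //.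
  by exists i => // j ltji; apply/eqP/(implyP (eqi j)).
- by left.
case=> -> [i lti eqi]; right; rewrite eqxx; apply/existsP; exists i.
by rewrite lti; apply/forallP=> j; apply/implyP=> /eqi->.
Qed.

Lemma grevlex_lt_irr m : grevlex_lt m m = false.
Proof. by apply/grevlex_ltP; case=> [|[_ [i]]]; rewrite ltnn. Qed.

Lemma grevlex_lt_trans : transitive (@grevlex_lt n).
Proof.
move=> m2 m1 m3 /grevlex_ltP[lt12|[eq12 [i lti eqi]]];
  case/grevlex_ltP=> [lt23|[eq23 [j ltj eqj]]]; apply/grevlex_ltP.
- by left; apply: ltn_trans lt23.
- by left; rewrite -eq23.
- by left; rewrite eq12.
right; split; first by rewrite eq12.
case: (ltngtP i j) => [ltij|ltji|/val_inj eqij].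
- exists i; first by rewrite -eqj.
  by move=> k ltki; rewrite eqi // eqj // (ltn_trans ltki).
- exists j; first by rewrite eqi.
  by move=> k ltkj; rewrite eqi ?eqj // (ltn_trans ltkj).
exists i; first by rewrite (ltn_trans _ lti) // eqij.
by move=> k ltki; rewrite eqi // eqj // -eqij.
Qed.

Lemma grevlex_lt_total m1 m2 : [|| m1 == m2, grevlex_lt m1 m2 | grevlex_lt m2 m1].
Proof.
case: eqVneq => //= ne12.
have [i nei mini] : exists2 i : 'I_n, m1 i != m2 i
    & forall j : 'I_n, (j < i)%N -> m1 j = m2 j.
  have [i0 ne0] : exists i, m1 i != m2 i.
    apply/existsP; apply: contraR ne12; rewrite negb_exists => /forallP eqm.
    by apply/eqP/mnmP => i; apply/eqP; move: (eqm i); rewrite negbK.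
  case: (@arg_minnP _ i0 (fun i => m1 i != m2 i) (fun i => i : nat) ne0) => i nei mini.
  exists i => // j ltji; apply/eqP; apply: contraLR ltji => /mini.
  by rewrite -leqNgt.
case: (ltngtP (mdeg m1) (mdeg m2)) => [lt|lt|eqd].
- by apply/orP; left; apply/grevlex_ltP; left.
- by apply/orP; right; apply/grevlex_ltP; left.
case: (ltngtP (m1 i) (m2 i)) nei => // lt _; apply/orP.
  by right; apply/grevlex_ltP; right; split=> //; exists i => // j /mini.
by left; apply/grevlex_ltP; right; split=> //; exists i.
Qed.

Lemma grevlex_lt_add2l m m1 m2 : grevlex_lt (m + m1) (m + m2) = grevlex_lt m1 m2.
Proof.
apply/grevlex_ltP/grevlex_ltP; rewrite !mdegD ltn_add2l.
  case=> [|[/addnI eqd [i lti eqi]]]; [by left|right; split=> //].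
  exists i => [|j /eqi]; first by rewrite !mnmDE ltn_add2l in lti.
  by rewrite !mnmDE => /addnI.
case=> [|[eqd [i lti eqi]]]; [by left|right; rewrite eqd; split=> //].
exists i => [|j /eqi]; first by rewrite !mnmDE ltn_add2l.
by rewrite !mnmDE => ->.
Qed.

Definition grevlex_le m1 m2 := (m1 == m2) || grevlex_lt m1 m2.

Lemma grevlex_le_refl m : grevlex_le m m.
Proof. by rewrite /grevlex_le eqxx. Qed.

Lemma grevlex_ltW m1 m2 : grevlex_lt m1 m2 -> grevlex_le m1 m2.
Proof. by rewrite /grevlex_le orbC => ->. Qed.

Lemma grevlex_le_trans : transitive grevlex_le.
Proof.
move=> m2 m1 m3 /predU1P[-> //|lt12] /predU1P[<-|lt23]; first exact: grevlex_ltW.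
exact/grevlex_ltW/(grevlex_lt_trans lt12).
Qed.

Lemma grevlex_le_anti : antisymmetric grevlex_le.
Proof.
move=> m1 m2 /andP[/predU1P[//|lt12] /predU1P[//|lt21]].
by have := grevlex_lt_trans lt12 lt21; rewrite grevlex_lt_irr.
Qed.

Lemma grevlex_le_total : total grevlex_le.
Proof.
move=> m1 m2; rewrite /grevlex_le (eq_sym m2).
by case/or3P: (grevlex_lt_total m1 m2) => ->; rewrite ?orbT.
Qed.

Lemma grevlex_le0 m : grevlex_le 0%MM m.
Proof.
rewrite /grevlex_le; case: eqVneq => //= nz; apply/grevlex_ltP; left.
by rewrite mdeg0 lt0n mdeg_eq0 eq_sym.
Qed.

Lemma grevlex_le_add m1 m2 m3 m4 :
  grevlex_le m1 m3 -> grevlex_le m2 m4 -> grevlex_le (m1 + m2) (m3 + m4).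
Proof.
move=> le13 le24; apply: (@grevlex_le_trans (m1 + m4)%MM).
  by rewrite /grevlex_le eqm_add2l grevlex_lt_add2l.
by rewrite ![(_ + m4)%MM]addmC /grevlex_le eqm_add2l grevlex_lt_add2l.
Qed.

Lemma grevlex_le_mdeg m1 m2 : grevlex_le m1 m2 -> (mdeg m1 <= mdeg m2)%N.
Proof. by case/predU1P=> [-> //|/grevlex_ltP[/ltnW //|[-> //]]]. Qed.

Lemma grevlex_exists_max (T : eqType) (f : T -> 'X_{1..n}) (s : seq T) :
  s != [::] -> exists2 t, t \in s & {in s, forall u, grevlex_le (f u) (f t)}.
Proof.
elim: s => // t [|u s] IHs _.
  by exists t; rewrite ?mem_head // => v; rewrite inE => /eqP->; apply: grevlex_le_refl.
have [//|v v_s max_v] := IHs _.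
case/orP: (grevlex_le_total (f t) (f v)) => le_tv.
  exists v; first by rewrite inE v_s orbT.
  by move=> w /predU1P[-> //|/max_v].
exists t; rewrite ?mem_head // => w /predU1P[->|/max_v le_wv].
  exact: grevlex_le_refl.
exact: grevlex_le_trans le_tv.
Qed.

End Grevlex.

(** * Lead monomials of products and of sums *)

Section LeadMonomials.
Variables (F : fieldType) (n : nat).
Implicit Types (q : {mpoly F[n]}) (m : 'X_{1..n}).

Definition bounded q m := forall m', q@_m' != 0 -> grevlex_le m' m.
(** A relational form of [lead_mon]; it forces $q\neq0$, so the convention for the lead monomial of
    0 stays out of the computations. *)
Definition is_lead q m := q@_m != 0 /\ bounded q m.

Lemma is_lead_uniq q m1 m2 : is_lead q m1 -> is_lead q m2 -> m1 = m2.
Proof.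
by case=> nz1 le1 [nz2 le2]; apply: grevlex_le_anti; rewrite le1 ?le2.
Qed.

Lemma is_lead_neq0 q m : is_lead q m -> q != 0.
Proof. by case=> nz _; apply: contraNneq nz => ->; rewrite mcoeff0. Qed.

Lemma lead_monP q : q != 0 -> is_lead q (lead_mon q).
Proof.
rewrite -msupp_eq0 => supp_nz; have [m m_q max_m] := grevlex_exists_max id supp_nz.
suff -> : lead_mon q = m by split=> [|m']; rewrite -mcoeff_msupp // => /max_m.
rewrite /lead_mon; apply: grevlex_le_anti.
(* The fold starts at [0%MM], the least monomial, so [m] bounds it; conversely [m] occurs in the
   list, so the fold bounds [m]. *)
elim: (msupp q) m_q max_m => // m0 s IHs m_s max_m; rewrite big_cons /grevlex_max.
have le0 : grevlex_le m0 m by apply: max_m; rewrite mem_head.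
have max_s : {in s, forall u, grevlex_le u m} by move=> u u_s; apply: max_m; rewrite inE u_s orbT.
set b := \big[_/_]_(_ <- s) _ in IHs *.
have le_b : grevlex_le b m.
  rewrite /b; elim: (s) max_s => [|u t IHt] max_t; first by rewrite big_nil grevlex_le0.
  rewrite big_cons /grevlex_max; case: ifP => _; last by apply: max_t; rewrite mem_head.
  by apply: IHt => v v_t; apply: max_t; rewrite inE v_t orbT.
case: ifP => lt0.
  rewrite le_b; case/predU1P: m_s => [eq0|/IHs/(_ max_s)]; last by rewrite le_b.
  by rewrite eq0; apply: grevlex_ltW.
rewrite le0; case/predU1P: m_s => [->|/IHs/(_ max_s)]; first exact: grevlex_le_refl.
rewrite le_b => le_mb; apply: (grevlex_le_trans le_mb).
by have := grevlex_lt_total m0 b; rewrite lt0 /grevlex_le eq_sym orFb.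
Qed.

Lemma is_leadE q m : is_lead q m -> lead_mon q = m.
Proof. by move=> lead_m; apply/(is_lead_uniq (lead_monP (is_lead_neq0 lead_m))). Qed.

Lemma bounded_trans q m1 m2 : bounded q m1 -> grevlex_le m1 m2 -> bounded q m2.
Proof. by move=> bnd le12 m /bnd/grevlex_le_trans; apply. Qed.

Lemma boundedD q1 q2 m : bounded q1 m -> bounded q2 m -> bounded (q1 + q2) m.
Proof.
move=> bnd1 bnd2 m'; rewrite mcoeffD.
by have [->|/bnd1 //] := eqVneq q1@_m' 0; rewrite add0r => /bnd2.
Qed.

Lemma boundedZ c q m : bounded q m -> bounded (c *: q) m.
Proof. by move=> bnd m'; rewrite mcoeffZ mulf_eq0 negb_or => /andP[_ /bnd]. Qed.

(** Adding a monomial is strictly monotone, so among the pairs of monomials below $m_1$ and $m_2$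
    only $(m_1,m_2)$ has sum $m_1+m_2$. The bounds need not be attained. *)
Lemma boundedM_coeff q1 q2 m1 m2 : bounded q1 m1 -> bounded q2 m2 ->
  bounded (q1 * q2) (m1 + m2) /\ (q1 * q2)@_(m1 + m2) = q1@_m1 * q2@_m2.
Proof.
move=> bnd1 bnd2.
have bnd_sum q m : bounded q m -> forall u, u \in msupp q -> grevlex_le u m.
  by move=> bnd u; rewrite mcoeff_msupp => /bnd.
split=> [m|].
  rewrite -mcoeff_msupp => /msuppM_le/allpairsP[[u v] /= [u_q v_q ->]].
  by apply: grevlex_le_add; [apply: bnd_sum u_q|apply: bnd_sum v_q].
rewrite [q1 in LHS]mpolyE [q2 in LHS]mpolyE big_distrlr /= raddf_sum /=.
have term u v : ((q1@_u *: 'X_[u]) * (q2@_v *: 'X_[v]))@_(m1 + m2)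
    = q1@_u * q2@_v * ((u + v == m1 + m2)%MM)%:R.
  by rewrite -scalerAl -scalerAr -mpolyXD !mcoeffZ mcoeffX mulrA.
have uniq_max u v : grevlex_le u m1 -> grevlex_le v m2 ->
    (u + v = m1 + m2)%MM -> u = m1 /\ v = m2.
  move=> le1 le2 eqs; case/predU1P: le1 => [eq1|lt1].
    by move: eqs; rewrite eq1 => /addmI->.
  have lts : grevlex_lt (v + u)%MM (v + m1)%MM by rewrite grevlex_lt_add2l.
  have := grevlex_le_add (grevlex_le_refl m1) le2.
  rewrite -eqs [(m1 + v)%MM]addmC [(u + v)%MM]addmC => /predU1P[eqv|/(grevlex_lt_trans lts)].
    by move: lts; rewrite eqv grevlex_lt_irr.
  by rewrite grevlex_lt_irr.
have [m1_q|m1_q] := boolP (m1 \in msupp q1); last first.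
  rewrite (memN_msupp_eq0 m1_q) mul0r big_seq big1 // => u u_q.
  rewrite raddf_sum big_seq big1 //= => v v_q; rewrite term.
  case: eqP => [/uniq_max[||eq1 _]|]; rewrite ?mulr0 ?bnd_sum //.
  1,2: by apply: bnd_sum; eassumption.
  by rewrite eq1 (negPf m1_q) in u_q.
rewrite (bigD1_seq m1) ?msupp_uniq //= [X in _ + X]big_seq_cond [X in _ + X]big1 ?addr0; last first.
  move=> u /andP[u_q ne]; rewrite raddf_sum big_seq big1 //= => v v_q; rewrite term.
  case: eqP => [/uniq_max[||eq1 _]|]; rewrite ?mulr0 //.
  1,2: by apply: bnd_sum; eassumption.
  by rewrite eq1 eqxx in ne.
rewrite raddf_sum /=.
have [m2_q|m2_q] := boolP (m2 \in msupp q2); last first.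
  rewrite (memN_msupp_eq0 m2_q) mulr0 big_seq big1 // => v v_q; rewrite term eqm_add2l.
  by case: eqP => [eqv|]; rewrite ?mulr0 //; rewrite eqv (negPf m2_q) in v_q.
rewrite (bigD1_seq m2) ?msupp_uniq //= big1 ?addr0 => [|v ne]; rewrite term eqm_add2l.
  by rewrite eqxx mulr1.
by rewrite (negPf ne) mulr0.
Qed.

Lemma is_leadM q1 q2 m1 m2 :
  is_lead q1 m1 -> is_lead q2 m2 -> is_lead (q1 * q2) (m1 + m2).
Proof.
move=> [nz1 bnd1] [nz2 bnd2]; have [bnd eqc] := boundedM_coeff bnd1 bnd2.
by split; rewrite // eqc mulf_neq0.
Qed.

Lemma is_leadXm m : is_lead 'X_[m] m.
Proof.
split=> [|m']; first by rewrite mcoeffX eqxx oner_neq0.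
by rewrite mcoeffX; case: (m =P m') => [-> _|_]; rewrite ?eqxx // grevlex_le_refl.
Qed.

Lemma is_lead1 : is_lead 1 0%MM.
Proof. by rewrite -mpolyX0; apply: is_leadXm. Qed.

Lemma is_leadXn q m k : is_lead q m -> is_lead (q ^+ k) (m *+ k).
Proof.
move=> lead_m; elim: k => [|k IHk]; first by rewrite expr0 mulm0n; apply: is_lead1.
by rewrite exprS mulmS; apply: is_leadM.
Qed.

Lemma is_lead_prod (I : eqType) (r : seq I) (q : I -> {mpoly F[n]}) (m : I -> 'X_{1..n}) :
  {in r, forall i, is_lead (q i) (m i)} ->
  is_lead (\prod_(i <- r) q i) (\big[+%MM/0%MM]_(i <- r) m i).
Proof.
elim: r => [|i r IHr] lead_r; first by rewrite !big_nil; apply: is_lead1.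
rewrite !big_cons; apply: is_leadM; first by apply: lead_r; rewrite mem_head.
by apply: IHr => j j_r; apply: lead_r; rewrite inE j_r orbT.
Qed.

(** The largest of the distinct lead monomials occurs in one summand only and cannot cancel. The
    coefficient is recorded because subduction compares lead terms. *)
Lemma is_lead_big_distinct (I : eqType) (s : seq I) (a : I -> F)
    (q : I -> {mpoly F[n]}) (m : I -> 'X_{1..n}) :
    uniq s -> s != [::] -> {in s, forall i, a i != 0} ->
    {in s, forall i, is_lead (q i) (m i)} -> {in s &, injective m} ->
  exists2 i, i \in s & is_lead (\sum_(j <- s) a j *: q j) (m i) /\
    (\sum_(j <- s) a j *: q j)@_(m i) = a i * (q i)@_(m i).
Proof.
move=> uniq_s s_nz a_nz lead_s inj_m.
have [i i_s max_i] := grevlex_exists_max m s_nz.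
have eqc : (\sum_(j <- s) a j *: q j)@_(m i) = a i * (q i)@_(m i).
  rewrite raddf_sum (bigD1_seq i) //= mcoeffZ big_seq_cond big1 ?addr0 // => j /andP[j_s ne].
  rewrite mcoeffZ; have [_ bnd] := lead_s j j_s.
  have [->|/bnd le_ij] := eqVneq (q j)@_(m i) 0; first by rewrite mulr0.
  have /(inj_m _ _ j_s i_s) eqij : m j = m i by apply: grevlex_le_anti; rewrite max_i.
  by rewrite eqij eqxx in ne.
exists i => //; split=> //; split.
  by rewrite eqc mulf_neq0 ?a_nz //; case: (lead_s i i_s).
rewrite big_seq; apply: (big_ind (fun q => bounded q (m i))).
- by move=> m'; rewrite mcoeff0 eqxx.
- by move=> ? ?; apply: boundedD.
by move=> j j_s; apply/boundedZ/bounded_trans/max_i/j_s; case: (lead_s j j_s).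
Qed.

End LeadMonomials.

(** * Polynomials invariant under translations *)

Section TranslationInvariants.
Variable D : idomainType.
Implicit Types (h Phi : {poly D}) (A : seq D).

Definition translation_invariant A h :=
  {in A, forall a, h \Po ('X + a%:P) = h}.

(* h - h(0) vanishes on A, and so does Phi - Phi(0), whose degree is #|A|: the
   latter divides the former, and the quotient is again invariant. *)
Lemma translation_invariant_comp A Phi h :
    (0 < size A)%N -> uniq A -> size Phi = (size A).+1 -> lead_coef Phi \is a GRing.unit ->
    translation_invariant A Phi -> translation_invariant A h ->
  exists H, h = H \Po Phi.
Proof.
move=> A_gt0 uniqA szPhi unitPhi invPhi.
have [n] := ubnP (size h); elim: n h => // n IHn h /ltnSE-szh invh.
have root_h k : translation_invariant A k -> all (root (k - k.[0]%:P)) A.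
  move=> invk; apply/allP => a /invk invka.
  by rewrite rootE !hornerE -{2}invka horner_comp !hornerE subrr.
(* In degree below the number of translations, $h-h(0)$ would have more roots than its degree
   allows, so $h$ is constant. *)
have [szhA|szAh] := leqP (size h) (size A).
  exists (h.[0])%:P; rewrite comp_polyC; apply/eqP; rewrite -subr_eq0.
  apply: contraTT (leqnn (size A)) => nz; rewrite -ltnNge.
  apply: leq_trans (max_poly_roots nz (root_h h invh) uniqA) _.
  apply: leq_trans (size_polyD _ _) _; rewrite size_polyN geq_max szhA.
  exact: leq_trans (size_polyC_leq1 _) _.
pose Phi0 := Phi - Phi.[0]%:P.
have szC c : (size (- c%:P : {poly D}) < size Phi)%N.
  by rewrite size_polyN szPhi ltnS (leq_trans (size_polyC_leq1 _)).
have szPhi0 : size Phi0 = (size A).+1 by rewrite size_polyDl.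
have unitPhi0 : lead_coef Phi0 \is a GRing.unit by rewrite lead_coefDl.
have Phi0_nz : Phi0 != 0 by rewrite -size_poly_gt0 szPhi0.
pose h0 := h - h.[0]%:P; pose q := h0 %/ Phi0.
have def_h0 : h0 = q * Phi0.
  rewrite {1}(Pdiv.IdomainUnit.divp_eq unitPhi0 h0) -/q.
  suff -> : h0 %% Phi0 = 0 by rewrite addr0.
  (* The remainder has degree below [size A] and vanishes on [A], because both [h0] and [Phi0]
     do. *)
  apply/eqP; apply: contraTT (leqnn (size A)) => nz; rewrite -ltnNge.
  have lt_sz : (size (h0 %% Phi0)%R <= size A)%N by rewrite -ltnS -szPhi0 Pdiv.Idomain.ltn_modp.
  apply: leq_trans lt_sz; apply: max_poly_roots nz _ uniqA.
  apply/allP => a aA; have /allP/(_ a aA) := root_h h invh.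
  rewrite -/h0 {1}(Pdiv.IdomainUnit.divp_eq unitPhi0 h0) !rootE hornerD hornerM.
  have /allP/(_ a aA)/eqP := root_h Phi invPhi.
  by rewrite -/Phi0 => ->; rewrite mulr0 add0r.
have invq : translation_invariant A q.
  move=> a aA; apply: (mulIf Phi0_nz); rewrite -def_h0.
  have <- : Phi0 \Po ('X + a%:P) = Phi0 by rewrite comp_polyB invPhi // comp_polyC.
  by rewrite -comp_polyM -def_h0 comp_polyB invh // comp_polyC.
have [q0|q_nz] := eqVneq q 0.
  exists (h.[0])%:P; rewrite comp_polyC; apply/eqP; rewrite -subr_eq0 -/h0.
  by rewrite def_h0 q0 mul0r.
have [|H def_q] := IHn q _ invq.
  apply: leq_trans szh; rewrite -ltnS.
  have -> : h = q * Phi0 + h.[0]%:P by rewrite -def_h0 subrK.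
  have szqP : size (q * Phi0) = (size q + size A)%N.
    by rewrite size_mul // szPhi0 addnS.
  rewrite size_polyDl szqP; first by rewrite ltnS -addn1 leq_add2l.
  apply: leq_ltn_trans (size_polyC_leq1 _) _.
  by rewrite -addn1 addnC leq_add // size_poly_gt0.
(* From $h=q\,\Phi_0+h(0)$ with $q=H\circ\Phi$ and $\Phi_0=\Phi-\Phi(0)$. *)
exists (H * ('X - Phi.[0]%:P) + h.[0]%:P).
rewrite comp_polyD comp_polyM comp_polyB comp_polyX !comp_polyC -def_q.
by rewrite -def_h0 subrK.
Qed.

(** One polynomial of each degree, with unit lead coefficients, gives a basis over [D]: subtracting
    a multiple of the member of the same degree lowers the degree. *)
Lemma poly_basis_ind (P : {poly D} -> Prop) (B : nat -> {poly D}) :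
    (forall n, size (B n) = n.+1) -> (forall n, lead_coef (B n) \is a GRing.unit) ->
    P 0 -> (forall h1 h2, P h1 -> P h2 -> P (h1 + h2)) ->
    (forall n d, P (d *: B n)) ->
  forall h, P h.
Proof.
move=> szB unitB P0 PD PB h.
have [n] := ubnP (size h); elim: n h => // n IHn h /ltnSE-szh.
have [->//|h_nz] := eqVneq h 0.
have szh_gt0 : (0 < size h)%N by rewrite size_poly_gt0.
pose k := (size h).-1; pose d := lead_coef h / lead_coef (B k).
have lt_sz : (size (h - d *: B k)%R < size h)%N.
  rewrite -(ltn_predK szh_gt0) ltnS; apply/leq_sizeP => j.
  rewrite leq_eqVlt => /predU1P[<-|ltkj].
    rewrite coefB coefZ /d lead_coefE [lead_coef (B k)]lead_coefE szB /=.
    by rewrite divrK ?subrr //; move: (unitB k); rewrite lead_coefE szB.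
  rewrite coefB coefZ !nth_default ?mulr0 ?subrr ?szB //.
  by rewrite -(ltn_predK szh_gt0).
rewrite -(subrK (d *: B k) h); apply: PD; last exact: PB.
by apply: IHn; apply: leq_trans szh.
Qed.

End TranslationInvariants.

(** * The action of the group *)

Lemma det_mx33 (R : comNzRingType) (M : 'M[R]_3) :
  \det M = M 0 0 * (M 1 1 * M 2 2 - M 1 2 * M 2 1)
         - M 0 1 * (M 1 0 * M 2 2 - M 1 2 * M 2 0)
         + M 0 2 * (M 1 0 * M 2 1 - M 1 1 * M 2 0).
Proof.
have det22 (B : 'M[R]_2) : \det B = B 0 0 * B 1 1 - B 0 1 * B 1 0.
  rewrite (expand_det_row _ 0) !big_ord_recl big_ord0 /cofactor !det_mx11 !mxE /=.
  have -> : lift 0 (0 : 'I_1) = 1 :> 'I_2 by exact/val_inj.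
  have -> : lift (1 : 'I_2) (0 : 'I_1) = 0 :> 'I_2 by exact/val_inj.
  rewrite /bump /=; ring.
rewrite (expand_det_row _ 0) !big_ord_recl big_ord0 /cofactor !det22 !mxE /=.
have -> : lift 0 (0 : 'I_2) = 1 :> 'I_3 by exact/val_inj.
have -> : lift 0 (1 : 'I_2) = 2 :> 'I_3 by exact/val_inj.
have -> : lift (1 : 'I_3) (0 : 'I_2) = 0 :> 'I_3 by exact/val_inj.
have -> : lift (1 : 'I_3) (1 : 'I_2) = 2 :> 'I_3 by exact/val_inj.
have -> : lift ord0 (lift ord0 ord0) = 2 :> 'I_3 by exact/val_inj.
have -> : lift (2 : 'I_3) (0 : 'I_2) = 0 :> 'I_3 by exact/val_inj.
have -> : lift (2 : 'I_3) (1 : 'I_2) = 1 :> 'I_3 by exact/val_inj.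
rewrite /bump /=; ring.
Qed.

Lemma comp_mpolyA (R : comNzRingType) n k l (s : n.-tuple {mpoly R[k]})
    (t : k.-tuple {mpoly R[l]}) q :
  (q \mPo s) \mPo t = q \mPo map_tuple (comp_mpoly t) s.
Proof.
rewrite !(comp_mpolyE q) raddf_sum; apply: eq_bigr => m _ /=.
rewrite comp_mpolyZ rmorph_prod; congr (_ *: _); apply: eq_bigr => i _ /=.
by rewrite rmorphXn /= tnth_map.
Qed.

Section Group.
Variables (p : nat) (F : fieldType) (c : 'M[F]_(2, 3)).
Hypotheses (p_prime : prime p) (charF : p \in [pchar F]).

Local Notation x := ('X_(inord 0) : {mpoly F[3]}).
Local Notation y := ('X_(inord 1) : {mpoly F[3]}).
Local Notation z := ('X_(inord 2) : {mpoly F[3]}).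
Local Notation G := 'rV['Z_p]_3.

Implicit Types (g : G) (w : 'I_3 -> F).

(** Rows are counted from 0 here and from 1 in [gamma]. *)
Definition Gamma_row w (r : nat) : F := \sum_j Gamma p c (inord r) j * w j.

(* The vector (Gamma_row w r)_r is a combination of the columns of Gamma, so the
   4x4 determinants on rows 1, 2, 3, 4 and 1, 2, 3, 5 of Gamma extended by this
   vector vanish; expand them along the last column. *)
Lemma gamma_dep w :
  gamma p c 1 2 3 * Gamma_row w 3 - gamma p c 1 2 4 * Gamma_row w 2
  + gamma p c 1 3 4 * Gamma_row w 1 - gamma p c 2 3 4 * Gamma_row w 0 = 0 /\
  gamma p c 1 2 3 * Gamma_row w 4 - gamma p c 1 2 5 * Gamma_row w 2
  + gamma p c 1 3 5 * Gamma_row w 1 - gamma p c 2 3 5 * Gamma_row w 0 = 0.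
Proof.
have gE i j k : gamma p c i j k =
    let G r s := Gamma p c (inord r.-1) s in
      G i 0 * (G j 1 * G k 2 - G j 2 * G k 1)
    - G i 1 * (G j 0 * G k 2 - G j 2 * G k 0)
    + G i 2 * (G j 0 * G k 1 - G j 1 * G k 0).
  by rewrite /gamma det_mx33 !mxE.
rewrite !gE /Gamma_row /= !big_ord_recl !big_ord0.
rewrite (_ : lift ord0 ord0 = 1); last exact/val_inj.
rewrite (_ : lift ord0 (lift ord0 ord0) = 2); last exact/val_inj.
by split; ring.
Qed.

(** The action of $g$ adds [yshift g] to $y/x$ and subtracts [dshift g] from $\delta/x^2$. *)
Definition yshift g : F := \sum_j c 0 j * (g 0 j : nat)%:R.
Definition dshift g : F := \sum_j c 1 j * (g 0 j : nat)%:R.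

(** The entries of $g$ lie in the prime field, which Frobenius fixes; so Frobenius powers of the
    shifts are obtained from the other rows of [Gamma] with the same coefficients. *)
Lemma Gamma_rowE g : let w j := (g 0 j : nat)%:R in
  [/\ Gamma_row w 0 = yshift g, Gamma_row w 1 = dshift g,
      Gamma_row w 2 = yshift g ^+ p, Gamma_row w 3 = dshift g ^+ p
    & Gamma_row w 4 = yshift g ^+ (p ^ 2)].
Proof.
move=> w; have pw j : w j ^+ p = w j.
  by rewrite -(pFrobenius_autE charF) pFrobenius_aut_nat.
have pS (f : 'I_3 -> F) : (\sum_j f j * w j) ^+ p = \sum_j f j ^+ p * w j.
  rewrite -(pFrobenius_autE charF) raddf_sum; apply: eq_bigr => j _ /=.
  by rewrite pFrobenius_autE exprMn pw.
have -> : yshift g ^+ (p ^ 2) = \sum_j c 0 j ^+ (p ^ 2) * w j.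
  by rewrite -mulnn exprM !pS; apply: eq_bigr => j _; rewrite exprM.
by rewrite !pS; split; apply: eq_bigr => j _; rewrite mxE inordK.
Qed.

(** The left-hand side is the change of $f_1/x^{2p}$ when $y/x$ and $\delta/x^2$ are shifted by $g$:
    this is the invariance of $f_1$. *)
Lemma phi1_dep g :
  gamma p c 1 2 3 * dshift g ^+ p - gamma p c 1 2 4 * yshift g ^+ p
  + gamma p c 1 3 4 * dshift g - gamma p c 2 3 4 * yshift g = 0.
Proof.
have := (gamma_dep (fun j => (g 0 j : nat)%:R)).1.
by have [-> -> -> -> _] := Gamma_rowE g.
Qed.

(** Likewise the left-hand side is the change of $f_2/x^{p^2}$ under $g$. *)
Lemma phi2_dep g :
  gamma p c 1 2 3 * yshift g ^+ (p ^ 2) - gamma p c 1 2 5 * yshift g ^+ p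
  + gamma p c 1 3 5 * dshift g - gamma p c 2 3 5 * yshift g = 0.
Proof.
have := (gamma_dep (fun j => (g 0 j : nat)%:R)).2.
by have [-> -> -> _ ->] := Gamma_rowE g.
Qed.

Lemma natr_Zp_add (u v : 'Z_p) : (((u + v)%R : 'Z_p) : nat)%:R = (u : nat)%:R + (v : nat)%:R :> F.
Proof.
have modp k : (k %% (Zp_trunc p).+2)%N%:R = k%:R :> F.
  by rewrite Zp_cast ?prime_gt1 // GRing.natr_mod_pchar.
by rewrite -natrD -[RHS]modp.
Qed.

Lemma yshiftD g h : yshift (g + h) = yshift g + yshift h.
Proof. by rewrite -big_split /=; apply: eq_bigr => j _; rewrite mxE natr_Zp_add mulrDr. Qed.

(** If [yshift g] vanishes, so do its Frobenius powers; hence rows 1, 3 and 5 of [Gamma] annihilate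
    the vector of entries of $g$, and their determinant is nonzero. *)
Lemma yshift_inj : gamma p c 1 3 5 != 0 -> injective yshift.
Proof.
move=> nz; suff inj0 g : yshift g = 0 -> g = 0.
  move=> g h eqa; apply/eqP; rewrite -subr_eq0; apply/eqP/inj0.
  by apply: (addIr (yshift h)); rewrite -yshiftD subrK add0r.
move=> a0; have [e0 _ e2 _ e4] := Gamma_rowE g.
pose w := \col_j (g 0 j : nat)%:R : 'cV[F]_3.
have p_gt0 := prime_gt0 p_prime.
have w0 : w = 0.
  apply: (row_full_inj (A := rowsub (tnth [tuple inord 0; inord 2; inord 4]) (Gamma p c))).
    by rewrite row_full_unit unitmxE unitfE.
  rewrite mulmx0; apply/colP => i; rewrite !mxE.
  transitivity (Gamma_row (fun j => (g 0 j : nat)%:R) (nth 0 [:: 0; 2; 4] i)%N).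
    apply: eq_bigr => j _; rewrite ![w _ _]mxE mxE (tnth_nth (inord 0)) /=.
    congr (Gamma _ _ _ _ * _).
    by case: i => [[|[|[|]]]] /=.
  case: i => [[|[|[|]]]] //= _; rewrite ?e0 ?e2 ?e4 a0 ?expr0n ?expn_eq0 //.
    by rewrite gtn_eqF.
  by rewrite gtn_eqF.
apply/rowP => j; rewrite [RHS]mxE; apply/val_inj => /=.
have /colP/(_ j) := w0; rewrite !mxE => /eqP; rewrite -(dvdn_pcharf charF) => /dvdnP[k].
have := ltn_ord (g 0 j); rewrite [X in (_ < X)%N]Zp_cast ?prime_gt1 //.
by case: k => [|k] lt eqk; rewrite eqk // mulSn ltnNge leq_addr in lt.
Qed.

Definition translate g : {mpoly F[3]} -> {mpoly F[3]} :=
  comp_mpoly [tuple x; y + yshift g *: x;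
    z + (2 * yshift g) *: y + (yshift g ^+ 2 + dshift g) *: x].

(** Substitutions with parameters $(a,b)$ compose by adding the parameters, so iterating a generator
    $k$ times multiplies its parameters by $k$. *)
Lemma group_actE g : group_act c g =1 translate g.
Proof.
pose T (a b : F) := [tuple x; y + a *: x; z + (2 * a) *: y + (a ^+ 2 + b) *: x].
have TT a b a' b' q : (q \mPo T a b) \mPo T a' b' = q \mPo T (a + a') (b + b').
  rewrite comp_mpolyA; congr (_ \mPo _); apply: val_inj => /=.
  congr [:: _; _; _]; rewrite ?comp_mpolyD ?comp_mpolyZ !comp_mpolyXU !inordK //=.
    by rewrite scalerDl -addrA; congr (_ + _); rewrite addrC.
  by rewrite -!mul_mpolyC !(rmorphD, rmorphM, rmorphXn) /=; ring.
have itT i k q : iter k (gen_act c i) q = q \mPo T (k%:R * c 0 i) (k%:R * c 1 i).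
  elim: k => [|k IHk] /=; last first.
    by rewrite IHk [LHS]TT -natr1 !mulrDl !mul1r.
  rewrite !mul0r /T !(mulr0, scale0r, expr0n, addr0).
  rewrite -[LHS]comp_mpoly_id; congr (_ \mPo _); apply: eq_from_tnth => i'.
  rewrite tnth_map tnth_ord_tuple (tnth_nth 0); case: i' => [[|[|[|]]]] //= ?;
    by congr 'X_[U_(_)]; apply/val_inj; rewrite /= inordK //.
move=> q; rewrite /group_act /translate !itT !TT.
have sumE i : \sum_j c i j * (g 0 j : nat)%:R =
   (g 0 (inord 0) : nat)%:R * c i (inord 0) + (g 0 (inord 1) : nat)%:R * c i (inord 1)
   + (g 0 (inord 2) : nat)%:R * c i (inord 2).
  rewrite !big_ord_recl big_ord0 addr0 addrA !(mulrC (c _ _)).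
  congr (_ + _ + _); congr ((g 0 _ : nat)%:R * c i _); apply/val_inj; rewrite /= inordK //.
by rewrite !addrA /yshift /dshift !sumE.
Qed.

End Group.

(** * Coordinates in which the group acts by translations *)

Section UnitDegree.
Variable D : idomainType.
Implicit Types h k : {poly D}.

(** The lead coefficient must be a unit because [D] is only a domain, while the division and basis
    arguments above divide by lead coefficients. *)
Definition unit_degree n h := size h = n.+1 /\ lead_coef h \is a GRing.unit.

Lemma unit_degree_neq0 n h : unit_degree n h -> h != 0.
Proof. by case=> szh _; rewrite -size_poly_eq0 szh. Qed.

Lemma unit_degreeM m n h k :
  unit_degree m h -> unit_degree n k -> unit_degree (m + n) (h * k).
Proof.
move=> udh udk; have [[szh uh] [szk uk]] := (udh, udk).
split; last by rewrite lead_coefM unitrM uh.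
by rewrite size_mul ?(unit_degree_neq0 udh) ?(unit_degree_neq0 udk) // szh szk addnS.
Qed.

Lemma unit_degreeX m n h : unit_degree m h -> unit_degree (m * n) (h ^+ n).
Proof.
move=> udh; elim: n => [|n IHn]; last by rewrite exprS mulnS; apply: unit_degreeM.
by rewrite muln0; split; rewrite ?size_poly1 ?lead_coef1 ?unitr1.
Qed.

Lemma unit_degree_prod (I : Type) (r : seq I) n (h : I -> {poly D}) :
  (forall i, unit_degree n (h i)) -> unit_degree (n * size r) (\prod_(i <- r) h i).
Proof.
move=> udh; elim: r => [|i r IHr].
  by rewrite big_nil muln0; split; rewrite ?size_poly1 ?lead_coef1 ?unitr1.
by rewrite big_cons mulnS; apply: unit_degreeM.
Qed.

Lemma unit_degreeDl n h k : unit_degree n h -> (size k <= n)%N -> unit_degree n (h + k).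
Proof.
by case=> szh uh szk; split; rewrite ?size_polyDl ?lead_coefDl ?szh.
Qed.

Lemma unit_degreeN n h : unit_degree n h -> unit_degree n (- h).
Proof. by case=> szh uh; split; rewrite ?size_polyN ?lead_coefN ?unitrN. Qed.

Lemma unit_degreeZ n d h : d \is a GRing.unit -> unit_degree n h -> unit_degree n (d%:P * h).
Proof.
move=> ud udh; rewrite -[n]add0n; apply: unit_degreeM => //.
split; rewrite ?lead_coefC // size_polyC.
by case: eqP ud => // ->; rewrite unitr0.
Qed.

Lemma unit_degreeXn n : unit_degree n ('X^n : {poly D}).
Proof. by split; rewrite ?size_polyXn // lead_coefXn unitr1. Qed.

Lemma unit_degree_comp m n h k : (0 < n)%N ->
  unit_degree m h -> unit_degree n k -> unit_degree (m * n) (h \Po k).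
Proof.
move=> n_gt0 udh [szk uk]; have [szh uh] := udh.
have hk_nz : h \Po k != 0 by rewrite comp_poly_eq0 ?szk // (unit_degree_neq0 udh).
split; last by rewrite lead_coef_comp ?szk // unitrM uh unitrX.
by rewrite -(@prednK (size (h \Po k))) ?size_poly_gt0 // size_comp_poly szh szk.
Qed.

Lemma unit_degree_comp_inv m n h k : (0 < n)%N ->
  unit_degree (m * n) (h \Po k) -> unit_degree n k -> unit_degree m h.
Proof.
move=> n_gt0 udhk [szk uk]; have [szhk uhk] := udhk.
have h_nz : h != 0 by rewrite -(@comp_poly_eq0 _ _ k) ?szk // (unit_degree_neq0 udhk).
split; last first.
  by move: uhk; rewrite lead_coef_comp ?szk // unitrM => /andP[].
have := size_comp_poly h k; rewrite szhk szk /= => /eqP; rewrite eqn_pmul2r // => /eqP->.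
by rewrite prednK // size_poly_gt0.
Qed.

End UnitDegree.

Lemma mpoly_rmorph_ext n (R : comNzRingType) (S : comNzRingType)
    (f g : {rmorphism {mpoly R[n]} -> S}) :
  (forall a : R, f a%:MP = g a%:MP) -> (forall i, f 'X_i = g 'X_i) -> f =1 g.
Proof.
move=> eqC eqX q; rewrite (mpolyE q) !raddf_sum; apply: eq_bigr => m _ /=.
rewrite -mul_mpolyC !rmorphM eqC; congr (_ * _).
rewrite mpolyXE_id !rmorph_prod; apply: eq_bigr => i _.
by rewrite !rmorphXn eqX.
Qed.

Lemma p2_gt2p p : (2 < p)%N -> (2 * p < p ^ 2)%N.
Proof. by rewrite -mulnn; nia. Qed.

Lemma expr_pD p (S : comNzRingType) (u v : S) k :
  p \in [pchar S] -> (u + v) ^+ (p ^ k) = u ^+ (p ^ k) + v ^+ (p ^ k).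
Proof.
move=> charS; apply: exprDn_pchar; rewrite pnatX pnatE ?charS //.
exact: pcharf_prime charS.
Qed.

Lemma expr_p1D p (S : comNzRingType) (u v : S) :
  p \in [pchar S] -> (u + v) ^+ p = u ^+ p + v ^+ p.
Proof. by move=> charS; have := expr_pD u v 1 charS. Qed.

Section Coordinates.
Variables (p : nat) (F : fieldType) (c : 'M[F]_(2, 3)).
Hypothesis p_gt2 : (2 < p)%N.

Local Notation x := ('X_(inord 0) : {mpoly F[3]}).
Local Notation y := ('X_(inord 1) : {mpoly F[3]}).
Local Notation z := ('X_(inord 2) : {mpoly F[3]}).
Local Notation G := 'rV['Z_p]_3.
Local Notation R := {mpoly F[3]}.
(* D stands for F[x, s], where s = f2 / x^(p^2), and the variable 'X of {poly D}
   for y / x. *)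
Variables (D : idomainType) (iota : {rmorphism F -> D}) (xD sD : D).
Local Notation E := {poly D}.
Local Notation gam := (gamma p c).

Definition scal (a : F) : E := (iota a)%:P.
Definition coord_x : E := xD%:P.
Definition coord_s : E := sD%:P.

HB.instance Definition _ := GRing.RMorphism.copy scal (polyC \o iota).

(* delta / x^2, obtained by solving f2 = x^(p^2) s for delta. *)
Definition coord_delta : E :=
  scal (gam 1 3 5)^-1 * (scal (gam 1 2 3) * 'X^(p ^ 2) - scal (gam 1 2 5) * 'X^p
    - scal (gam 2 3 5) * 'X - coord_s).

(* z / x *)
Definition coord_z : E := 'X^2 - coord_delta.

Definition phi1 : E :=
  - (scal (gam 1 2 3) * coord_delta ^+ p) - scal (gam 1 2 4) * 'X^p
  - scal (gam 1 3 4) * coord_delta - scal (gam 2 3 4) * 'X.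

Definition coordinates (i : 'I_3) : E := nth 0 [:: coord_x; coord_x * 'X; coord_x * coord_z] i.

(** The change of coordinates that turns the action of $G$ into translations of $Y=y/x$
    ([theta_translate]). *)
Definition theta : R -> E := mmap scal coordinates.

HB.instance Definition _ := GRing.RMorphism.copy theta (mmap scal coordinates).

Lemma thetaC a : theta a%:MP = scal a. Proof. exact: mmapC. Qed.
Lemma thetaZ a q : theta (a *: q) = scal a * theta q. Proof. exact: mmapZ. Qed.
Lemma theta_x : theta x = coord_x. Proof. by rewrite /theta mmapX mmap1U /coordinates inordK. Qed.
Lemma theta_y : theta y = coord_x * 'X. Proof. by rewrite /theta mmapX mmap1U /coordinates inordK. Qed.
Lemma theta_z : theta z = coord_x * coord_z. Proof. by rewrite /theta mmapX mmap1U /coordinates inordK. Qed.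
Definition thetaE := (thetaZ, theta_x, theta_y, theta_z).

Lemma theta_delta : theta (delta F) = coord_x ^+ 2 * coord_delta.
Proof.
rewrite /delta rmorphB rmorphXn rmorphM /= !thetaE /coord_z; ring.
Qed.

Lemma theta_f1 : theta (f1 p c) = coord_x ^+ (2 * p) * phi1.
Proof.
rewrite /f1; move: (delta F) theta_delta => d theta_d.
rewrite !(rmorphB, rmorphN) /= !thetaZ !(rmorphXn, rmorphM) /= ?rmorphXn /= theta_d !thetaE /phi1.
rewrite [(coord_x ^+ 2 * coord_delta) ^+ p]exprMn [(coord_x * 'X) ^+ p]exprMn -[(coord_x ^+ 2) ^+ p]exprM.
have -> : coord_x ^+ p * (coord_x ^+ p * 'X^p) = coord_x ^+ (2 * p) * 'X^p by rewrite mulrA -exprD addnn mul2n.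
have -> : coord_x ^+ 2 * coord_delta * coord_x ^+ (2 * p - 2) = coord_x ^+ (2 * p) * coord_delta.
  by rewrite mulrAC -exprD; congr (_ ^+ _ * _); lia.
have -> : coord_x * 'X * coord_x ^+ (2 * p - 1) = coord_x ^+ (2 * p) * 'X.
  by rewrite mulrAC -exprS; congr (_ ^+ _ * _); lia.
rewrite !mulrBr !mulrN; congr (_ - _ - _ - _); ring.
Qed.

Hypothesis g135 : gamma p c 1 3 5 != 0.

Lemma scal_delta : scal (gam 1 3 5) * coord_delta =
  scal (gam 1 2 3) * 'X^(p ^ 2) - scal (gam 1 2 5) * 'X^p - scal (gam 2 3 5) * 'X - coord_s.
Proof. by rewrite /coord_delta mulrA -[scal _ * scal _]rmorphM mulfV // rmorph1 mul1r. Qed.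

Lemma theta_f2 : theta (f2 p c) = coord_x ^+ (p ^ 2) * coord_s.
Proof.
have lt2p := p2_gt2p p_gt2.
rewrite /f2; move: (delta F) theta_delta => d theta_d.
rewrite !(rmorphB, rmorphN) /= !thetaZ !(rmorphXn, rmorphM) /= ?rmorphXn /= theta_d !thetaE.
rewrite [(coord_x * 'X) ^+ p]exprMn [(coord_x * 'X) ^+ (p ^ 2)]exprMn.
have -> : coord_x ^+ p * 'X^p * coord_x ^+ (p ^ 2 - p) = coord_x ^+ (p ^ 2) * 'X^p.
  by rewrite mulrAC -exprD; congr (_ ^+ _ * _); lia.
have -> : coord_x ^+ 2 * coord_delta * coord_x ^+ (p ^ 2 - 2) = coord_x ^+ (p ^ 2) * coord_delta.
  by rewrite mulrAC -exprD; congr (_ ^+ _ * _); lia.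
have -> : coord_x * 'X * coord_x ^+ (p ^ 2 - 1) = coord_x ^+ (p ^ 2) * 'X.
  by rewrite mulrAC -exprS; congr (_ ^+ _ * _); lia.
have -> : coord_s = scal (gam 1 2 3) * 'X^(p ^ 2) - scal (gam 1 2 5) * 'X^p
    - scal (gam 2 3 5) * 'X - scal (gam 1 3 5) * coord_delta by rewrite scal_delta; ring.
ring.
Qed.

Hypotheses (p_prime : prime p) (charF : p \in [pchar F]).

Definition shiftD (g : G) : D := iota (yshift c g).
Definition shift (g : G) : E -> E := comp_poly ('X + (shiftD g)%:P).
HB.instance Definition _ g := GRing.RMorphism.copy (shift g) (comp_poly ('X + (shiftD g)%:P)).

Lemma shiftE g h : shift g h = h \Po ('X + (shiftD g)%:P). Proof. by []. Qed.
Lemma shift_comp_poly g (h k : E) : shift g (h \Po k) = h \Po shift g k.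
Proof. by rewrite !shiftE comp_polyA. Qed.
Lemma shift_scal g a : shift g (scal a) = scal a. Proof. exact: comp_polyC. Qed.
Lemma shift_X g : shift g 'X = 'X + scal (yshift c g). Proof. exact: comp_polyX. Qed.
Lemma shift_s g : shift g coord_s = coord_s. Proof. exact: comp_polyC. Qed.
Lemma shift_x g : shift g coord_x = coord_x. Proof. exact: comp_polyC. Qed.

Lemma charE : p \in [pchar E]. Proof. exact: (rmorph_pchar scal). Qed.
Lemma charR : p \in [pchar R]. Proof. exact: (rmorph_pchar (@mpolyC 3 F)). Qed.

(** Every shift fixes $s$, so the equation defining [coord_delta] dictates how it moves; [phi2_dep]
    identifies the displacement. *)
Lemma shift_delta g : shift g coord_delta = coord_delta - scal (dshift c g).
Proof.
have scal_nz : scal (gam 1 3 5) != 0 by rewrite polyC_eq0 fmorph_eq0.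
apply: (mulfI scal_nz); rewrite mulrBr scal_delta -{1}(shift_scal g) -rmorphM scal_delta.
rewrite !(rmorphB, rmorphXn, rmorphM) /= !shift_scal shift_s shift_X.
rewrite expr_pD ?charE // expr_p1D ?charE //.
have := congr1 scal (phi2_dep c charF g).
rewrite !(rmorphB, rmorphD, rmorphM, rmorphXn) rmorph0 /= => dep.
by apply/eqP; rewrite -subr_eq0 -dep; apply/eqP; ring.
Qed.

Lemma shift_phi1 g : shift g phi1 = phi1.
Proof.
rewrite /phi1; move: coord_delta (shift_delta g) => d shift_d.
rewrite !(rmorphB, rmorphN) !(rmorphXn, rmorphM) /= ?rmorphXn /= !shift_scal shift_d shift_X.
rewrite !expr_p1D ?charE //.
have -> : (- scal (dshift c g)) ^+ p = - scal (dshift c g) ^+ p.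
  by rewrite exprNn -signr_odd (_ : odd p) ?expr1 ?mulN1r //; case/even_prime: p_prime p_gt2 => [->|].
have := congr1 scal (phi1_dep c charF g).
rewrite !(rmorphB, rmorphD, rmorphXn, rmorphM) rmorph0 /= => dep.
by apply/eqP; rewrite -subr_eq0 -dep; apply/eqP; ring.
Qed.

Lemma shift_z g : shift g coord_z =
  coord_z + scal (2 * yshift c g) * 'X + scal (yshift c g ^+ 2 + dshift c g).
Proof.
rewrite /coord_z; move: coord_delta (shift_delta g) => d shift_d.
rewrite rmorphB rmorphXn /= shift_X shift_d.
by rewrite !(rmorphD, rmorphXn, rmorphM, rmorph1) /=; ring.
Qed.

Lemma theta_translate g q : theta (translate c g q) = shift g (theta q).
Proof.
apply: (@mpoly_rmorph_ext 3 F E (theta \o translate c g) (shift g \o theta)) => [a|i] /=.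
  by rewrite /translate comp_mpolyC thetaC shift_scal.
rewrite /translate comp_mpolyXU; case: i => [[|[|[|]]]] //= lti.
- by rewrite theta_x /theta mmapX mmap1U /= shift_x.
- rewrite [in RHS]/theta mmapX mmap1U /coordinates /= rmorphM /= shift_x shift_X rmorphD /=.
  by rewrite !thetaE; ring.
- rewrite [in RHS]/theta mmapX mmap1U /coordinates /= rmorphM /= shift_x shift_z !rmorphD /=.
  by rewrite !thetaE; ring.
Qed.

End Coordinates.

(** * Expansion of the numerator of $f_3$ and of $f_3$ itself *)

Lemma exprD_divisible (S : comNzRingType) (s t u : S) k :
  exists w, (s + t * u) ^+ k = s ^+ k + t * w.
Proof.
elim: k => [|k [w IHk]]; first by exists 0; rewrite !expr0 mulr0 addr0.
by exists (s * w + u * s ^+ k + u * t * w); rewrite !exprS IHk; ring.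
Qed.

(* Modulo x^(p^2 - 1) only a cross term of the square of f2 survives. *)
Lemma f3_numerator_expansion (S : comNzRingType) (p : nat)
    (x y z a b e h u : S) (d := y ^+ 2 - x * z) (v := e * d + h * (y * x))
    (g1 := - (a * d ^+ p) - x ^+ p * u)
    (g2 := a * y ^+ (p ^ 2) - b * (y ^+ p * x ^+ (p ^ 2 - p)) - x ^+ (p ^ 2 - 2) * v) :
  prime p -> (2 < p)%N -> p \in [pchar S] ->
  exists W, g1 ^+ p + a ^+ (p - 2) * g2 ^+ 2
      + 2 * (- a) ^+ ((p - 3) %/ 2) * b * (x ^+ (p ^ 2 - p) * g1 ^+ ((p + 1) %/ 2))
    = x ^+ (p ^ 2 - 2) * (- 2 * (a ^+ (p - 1) * (y ^+ (p ^ 2) * v)) + x * W).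
Proof.
move=> p_prime p_gt2 charS.
have p2 : (2 * p < p ^ 2)%N by rewrite -mulnn; nia.
have p2' : (p ^ 2 = p * p)%N by rewrite mulnn.
have p_odd : odd p by case/even_prime: p_prime p_gt2 => [->|].
have pE : p = (((p - 3) %/ 2).*2 + 3)%N.
  by rewrite -muln2; have := modn2 p; rewrite p_odd; lia.
set m := ((p - 3) %/ 2)%N in pE *.
have k2 : (2 * (m + 2) = p + 1)%N by move: pE; rewrite -muln2; lia.
have k_def : ((p + 1) %/ 2 = m + 2)%N by rewrite -k2 mulKn.
have oddN (q : S) : (- q) ^+ p = - q ^+ p by rewrite exprNn -signr_odd p_odd expr1 mulN1r.
pose Y := y ^+ p; pose Y2 := y ^+ (p ^ 2); pose t := x ^+ (p ^ 2 - 2).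
pose r := x ^+ (p ^ 2 - p).
have dpD (q1 q2 : S) : (q1 - q2) ^+ p = q1 ^+ p - q2 ^+ p by rewrite expr_p1D // oddN.
have dp : d ^+ p = Y ^+ 2 - x ^+ p * z ^+ p by rewrite /d dpD [(x * z) ^+ p]exprMn exprAC.
(* The $p$-th power is additive. The head $-a^py^{2p^2}$ will cancel the head of the second summand,
   and the rest carries $x^{p^2}=x^{p^2-2}x^2$. *)
have g1p : g1 ^+ p = - (a ^+ p * Y2 ^+ 2) + t * (x ^+ 2 * (a ^+ p * z ^+ (p ^ 2) - u ^+ p)).
  have -> : t * (x ^+ 2 * (a ^+ p * z ^+ (p ^ 2) - u ^+ p))
      = x ^+ (p ^ 2) * (a ^+ p * z ^+ (p ^ 2) - u ^+ p).
    by rewrite mulrA -exprD subnK //; lia.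
  rewrite /g1 dpD oddN [(a * _) ^+ p]exprMn [(x ^+ p * u) ^+ p]exprMn dp dpD.
  rewrite [(Y ^+ 2) ^+ p]exprAC [(x ^+ p * z ^+ p) ^+ p]exprMn -![_ ^+ p ^+ p]exprM mulnn.
  by rewrite -/Y2; ring.
(* Modulo $x^p$ the factor $\delta^p$ is $y^{2p}$, and $2p(p+1)/2=p^2+p$. *)
have [w g1k] : exists w, g1 ^+ (m + 2) = (- a) ^+ (m + 2) * (Y2 * Y) + x ^+ p * w.
  have [w Ew] := exprD_divisible (- a * Y ^+ 2) (x ^+ p) (a * z ^+ p - u) (m + 2).
  exists w.
  have <- : (- a * Y ^+ 2) ^+ (m + 2) = (- a) ^+ (m + 2) * (Y2 * Y).
    rewrite [LHS]exprMn; congr (_ * _); rewrite /Y2 /Y -!exprM -exprD; congr (_ ^+ _).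
    by rewrite -mulnA k2 mulnDr muln1 p2'.
  by rewrite -Ew /g1 dp; congr (_ ^+ _); ring.
have xt : t = x * x ^+ (p ^ 2 - 3) by rewrite -exprS; congr (_ ^+ _); lia.
have xr : r = x * x ^+ (p ^ 2 - p - 1) by rewrite -exprS; congr (_ ^+ _); lia.
have xrp : r * x ^+ p = t * x ^+ 2 by rewrite -!exprD; congr (_ ^+ _); lia.
have rr : r ^+ 2 = t * x * x ^+ (p ^ 2 - 2 * p + 1).
  by rewrite -exprSr -exprD -exprM; congr (_ ^+ _); lia.
(* With $m=(p-3)/2$ the exponents add up to the even number $p-1$; so the third summand cancels the
   cross term in $y^{p^2+p}x^{p^2-p}$ of the second. *)
have aa : (- a) ^+ m * (- a) ^+ (m + 2) = a ^+ (p - 1).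
  rewrite -exprD exprNn -signr_odd (_ : odd _ = false); last by rewrite addnA addnn oddD odd_double.
  by rewrite mul1r; congr (_ ^+ _); rewrite {1}pE; lia.
have ap1 : a ^+ (p - 1) = a ^+ (p - 2) * a by rewrite -exprSr; congr (_ ^+ _); lia.
have ap : a ^+ p = a ^+ (p - 2) * a ^+ 2 by rewrite -exprD; congr (_ ^+ _); lia.
exists (x * (a ^+ p * z ^+ (p ^ 2) - u ^+ p)
  + a ^+ (p - 2) * (b ^+ 2 * Y ^+ 2 * x ^+ (p ^ 2 - 2 * p + 1)
     + 2 * b * Y * x ^+ (p ^ 2 - p - 1) * v + x ^+ (p ^ 2 - 3) * v ^+ 2)
  + 2 * (- a) ^+ m * b * x * w).
rewrite k_def g1k g1p /g2 -/Y -/Y2 -/t -/r.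
apply/eqP; rewrite -subr_eq0; apply/eqP.
have {xt} xt : t - x * x ^+ (p ^ 2 - 3) = 0 by rewrite -xt subrr.
have {xr} xr : r - x * x ^+ (p ^ 2 - p - 1) = 0 by rewrite -xr subrr.
have {xrp} xrp : r * x ^+ p - t * x ^+ 2 = 0 by rewrite xrp subrr.
have {rr} rr : r ^+ 2 - t * x * x ^+ (p ^ 2 - 2 * p + 1) = 0 by rewrite -rr subrr.
have {aa} aa : (- a) ^+ m * (- a) ^+ (m + 2) - a ^+ (p - 2) * a = 0 by rewrite aa ap1 subrr.
rewrite ap1 ap.
(* The difference of the two sides is a combination of the five vanishing differences above; once
   the powers are opaque this is a polynomial identity. *)
transitivity (a ^+ (p - 2) * (b ^+ 2 * Y ^+ 2 * (r ^+ 2 - t * x * x ^+ (p ^ 2 - 2 * p + 1))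
     + 2 * b * Y * v * t * (r - x * x ^+ (p ^ 2 - p - 1))
     + v ^+ 2 * t * (t - x * x ^+ (p ^ 2 - 3)))
  + 2 * (- a) ^+ m * b * w * (r * x ^+ p - t * x ^+ 2)
  + 2 * b * r * Y2 * Y * ((- a) ^+ m * (- a) ^+ (m + 2) - a ^+ (p - 2) * a)); last first.
  by rewrite xt xr xrp rr aa !mulr0 !addr0 mulr0.
move: (x ^+ p) (x ^+ (p ^ 2 - 3)) (x ^+ (p ^ 2 - p - 1)) (x ^+ (p ^ 2 - 2 * p + 1))
  ((- a) ^+ m) ((- a) ^+ (m + 2)) (a ^+ (p - 2)) (z ^+ (p ^ 2)) (u ^+ p) => *.
move: (t) (r) (Y) (Y2) (v) => *.
ring.
Qed.

Section Generators.
Variables (p : nat) (F : fieldType) (c : 'M[F]_(2, 3)).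
Hypothesis p_gt2 : (2 < p)%N.

Local Notation x := ('X_(inord 0) : {mpoly F[3]}).
Local Notation y := ('X_(inord 1) : {mpoly F[3]}).
Local Notation z := ('X_(inord 2) : {mpoly F[3]}).
Local Notation gam := (gamma p c).

Definition f1_tail : {mpoly F[3]} :=
  (gam 1 2 4)%:MP * y ^+ p + (gam 1 3 4)%:MP * (delta F * x ^+ (p - 2))
  + (gam 2 3 4)%:MP * (y * x ^+ (p - 1)).

Lemma f1E : f1 p c = - ((gam 1 2 3)%:MP * delta F ^+ p) - x ^+ p * f1_tail.
Proof.
rewrite /f1 /f1_tail -!mul_mpolyC.
have -> : x ^+ (2 * p - 2) = x ^+ p * x ^+ (p - 2) by rewrite -exprD; congr (_ ^+ _); lia.
have -> : x ^+ (2 * p - 1) = x ^+ p * x ^+ (p - 1) by rewrite -exprD; congr (_ ^+ _); lia.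
by move: (delta F) => d; ring.
Qed.

Definition f3_head : {mpoly F[3]} :=
  (gam 1 3 5)%:MP * delta F + (gam 2 3 5)%:MP * (y * x).

Lemma f2E : f2 p c = (gam 1 2 3)%:MP * y ^+ (p ^ 2)
  - (gam 1 2 5)%:MP * (y ^+ p * x ^+ (p ^ 2 - p)) - x ^+ (p ^ 2 - 2) * f3_head.
Proof.
rewrite /f2 /f3_head -!mul_mpolyC.
have -> : x ^+ (p ^ 2 - 1) = x ^+ (p ^ 2 - 2) * x.
  by rewrite -exprSr; congr (_ ^+ _); have := p2_gt2p p_gt2; lia.
by move: (delta F) => d; ring.
Qed.

Hypotheses (p_prime : prime p) (charF : p \in [pchar F]).

Lemma two_neq0 : 2 != 0 :> F.
Proof.
have := dvdn_pcharf charF 2; rewrite gtnNdvd // => /esym/negbT.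
by [].
Qed.

(** The first part determines $f_3$ modulo $x$; the second says that the division performed by
    [monom_quo] is exact. *)
Lemma f3E : exists W, f3 p c =
    (gam 1 2 3 ^+ (p - 1))%:MP * (y ^+ (p ^ 2) * f3_head) + x * W
  /\ f3_numerator p c = - 2 *: (x ^+ (p ^ 2 - 2) * f3 p c).
Proof.
have n2 : - 2 != 0 :> F by rewrite oppr_eq0 two_neq0.
have [W EW] := f3_numerator_expansion x y z (gam 1 2 3)%:MP (gam 1 2 5)%:MP
  (gam 1 3 5)%:MP (gam 2 3 5)%:MP f1_tail p_prime p_gt2 (charR charF).
rewrite -/(delta F) -/f3_head in EW; rewrite -f1E -f2E in EW.
have En : f3_numerator p c = x ^+ (p ^ 2 - 2) *
   (- 2 * ((gam 1 2 3)%:MP ^+ (p - 1) * (y ^+ (p ^ 2) * f3_head)) + x * W).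
  rewrite -EW /f3_numerator -!mul_mpolyC -rmorphXn /=.
  rewrite !(rmorphXn, rmorphM, rmorphN) /=.
  by rewrite ?(rmorphXn, rmorphM, rmorphN, rmorph_nat) /=.
have m2 : - 2 = (- 2)%:MP :> {mpoly F[3]} by rewrite rmorphN rmorph_nat.
have Ef : f3 p c = (- 2)^-1 *:
   (- 2 * ((gam 1 2 3)%:MP ^+ (p - 1) * (y ^+ (p ^ 2) * f3_head)) + x * W).
  by rewrite /f3 En mpolyXn monom_quoK.
exists ((- 2)^-1 *: W); split.
  rewrite Ef scalerDr -[x * (_ *: W)]scalerAr; congr (_ + _); rewrite m2 -rmorphXn /=.
  by rewrite -!mul_mpolyC [LHS]mulrA -(rmorphM (@mpolyC 3 F)) /= mulVf // rmorph1 mul1r.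
by rewrite Ef -scalerAr scalerA mulfV // scale1r.
Qed.

End Generators.

(** * Degrees in $Y=y/x$ *)

Section Degrees.
Variables (p : nat) (F : fieldType) (c : 'M[F]_(2, 3)).
Hypotheses (p_prime : prime p) (p_gt2 : (2 < p)%N) (charF : p \in [pchar F]).
Hypotheses (g123 : gamma p c 1 2 3 != 0) (g135 : gamma p c 1 3 5 != 0).
Variables (D : idomainType) (iota : {rmorphism F -> D}) (xD sD : D).

Local Notation z := ('X_(inord 2) : {mpoly F[3]}).
Local Notation G := 'rV['Z_p]_3.
Local Notation R := {mpoly F[3]}.
Local Notation E := {poly D}.
Local Notation gam := (gamma p c).
Local Notation scal := (scal iota).
Local Notation coord_x := (coord_x xD).
Local Notation coord_s := (coord_s sD).
Local Notation coord_delta := (coord_delta p c iota sD).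
Local Notation coord_z := (coord_z p c iota sD).
Local Notation phi1 := (phi1 p c iota sD).
Local Notation theta := (theta p c iota xD sD).
Local Notation shift := (@shift p F c D iota).

Lemma iota_unit a : a != 0 -> iota a \is a GRing.unit.
Proof. by move=> nz; rewrite rmorph_unit ?unitfE. Qed.

Lemma size_scalM a n (h : E) : (size h <= n)%N -> (size (scal a * h)%R <= n)%N.
Proof. by move=> szh; rewrite mul_polyC (leq_trans (size_scale_leq _ _)). Qed.

Lemma size_subr_leq n (h k : E) : (size h <= n)%N -> (size k <= n)%N -> (size (h - k)%R <= n)%N.
Proof.
by move=> szh szk; rewrite (leq_trans (size_polyD _ _)) // size_polyN geq_max szh.
Qed.

Lemma coord_delta_degree : unit_degree (p ^ 2) coord_delta.
Proof.
have lt2p := p2_gt2p p_gt2; rewrite /coord_delta; apply: unit_degreeZ.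
  by rewrite iota_unit ?invr_eq0.
rewrite -!addrA; apply: unit_degreeDl.
  by apply: unit_degreeZ (unit_degreeXn _ _); rewrite iota_unit.
rewrite addrA -opprD; apply: size_subr_leq; last first.
  by rewrite (leq_trans (size_polyC_leq1 _)) //; lia.
rewrite size_polyN; apply: leq_trans (size_polyD _ _) _; rewrite geq_max.
by rewrite !size_scalM // ?size_polyXn ?size_polyX; lia.
Qed.

Lemma coord_z_degree : unit_degree (p ^ 2) coord_z.
Proof.
have lt2p := p2_gt2p p_gt2; rewrite /coord_z addrC.
by apply: unit_degreeDl; [apply/unit_degreeN/coord_delta_degree|rewrite size_polyXn; lia].
Qed.

(** The dominant term is $-\gamma_{123}(\delta/x^2)^p$, where $\delta/x^2$ has degree $p^2$ and lead
    coefficient $\gamma_{123}/\gamma_{135}$. *)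
Lemma phi1_degree : unit_degree (p ^ 3) phi1.
Proof.
have lt2p := p2_gt2p p_gt2; have lt3 : (p ^ 2 < p ^ 3)%N by rewrite ltn_exp2l //; lia.
have [szd _] := coord_delta_degree.
rewrite /phi1 -!addrA; apply: unit_degreeDl.
  apply/unit_degreeN/unit_degreeZ; first by rewrite iota_unit.
  by rewrite (expnSr p 2); apply/unit_degreeX/coord_delta_degree.
rewrite addrA -opprD; apply: size_subr_leq; last by rewrite size_scalM // size_polyX; lia.
rewrite size_polyN; apply: leq_trans (size_polyD _ _) _; rewrite geq_max.
by apply/andP; split; apply: size_scalM; rewrite ?size_polyXn ?szd; lia.
Qed.

Definition translations : seq D := [seq shiftD c iota g | g <- enum G].

Lemma size_translations : size translations = (p ^ 3)%N.
Proof.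
rewrite size_map -cardE card_mx mul1n; congr (_ ^ _)%N.
by rewrite card_ord Zp_cast ?prime_gt1.
Qed.

Lemma uniq_translations : uniq translations.
Proof.
rewrite map_inj_uniq ?enum_uniq // => g h /fmorph_inj.
exact: (yshift_inj p_prime charF g135).
Qed.

(** The degree $p^3$ of [phi1] equals the number of distinct translations, as
    [translation_invariant_comp] demands. *)
Lemma shift_invariant_comp (h : E) : (forall g, shift g h = h) ->
  exists H, h = H \Po phi1.
Proof.
move=> invh; have [szphi uphi] := phi1_degree.
apply: (@translation_invariant_comp D translations) => //.
- by rewrite size_translations expn_gt0 prime_gt0.
- exact: uniq_translations.
- by rewrite size_translations szphi.
- by move=> _ /mapP[g _ ->]; exact: shift_phi1.
by move=> _ /mapP[g _ ->]; exact: invh.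
Qed.

(** This is $N_G(z)/x^{p^3}$ (see [theta_N]). *)
Definition nu : E := \prod_(g : G) shift g coord_z.

Lemma nu_degree : unit_degree (p ^ 2 * p ^ 3) nu.
Proof.
have sz : size (index_enum G) = (p ^ 3)%N.
  by rewrite -size_translations size_map enumT.
rewrite /nu -sz; apply: unit_degree_prod => g; rewrite -[(p ^ 2)%N]muln1.
apply: unit_degree_comp coord_z_degree _ => //.
by split; rewrite ?size_XaddC ?lead_coefXaddC ?unitr1.
Qed.

Lemma shift_comp g h (q : E) : shift g (shift h q) = shift (g + h) q.
Proof.
rewrite !shiftE -comp_polyA comp_polyD comp_polyX comp_polyC -addrA -polyCD.
by rewrite -(rmorphD iota) /shiftD yshiftD.
Qed.

Lemma shift_nu g : shift g nu = nu.
Proof.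
rewrite /nu rmorph_prod /= [RHS](reindex_inj (addrI g)) /=.
by apply: eq_bigr => h _; apply: shift_comp.
Qed.

(** The coefficient of $y$ in the image of $z$ is [2 * yshift c g], which determines $g$ as $p$ is
    odd. So the orbit has $p^3$ elements and [undup] removes nothing. *)
Lemma orbit_injective : injective (fun g : G => group_act c g z).
Proof.
move=> g h; rewrite !group_actE // /translate !comp_mpolyXU !inordK //=.
move/(congr1 (mcoeff U_(inord 1))); rewrite !(mcoeffD, mcoeffZ) !mcoeffX.
rewrite !eq_mnm1 -!val_eqE /= !inordK //= !mulr0 !addr0 !add0r !mulr1.
move/(mulfI (two_neq0 p_gt2 charF)); exact: yshift_inj.
Qed.

Lemma orbit_productE : orbit_product p c z = \prod_(g : G) translate c g z.
Proof.
rewrite /orbit_product undup_id; last by rewrite map_inj_uniq ?enum_uniq //; apply: orbit_injective.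
rewrite big_map big_enum; apply: eq_bigr => g _; exact: group_actE.
Qed.

Lemma theta_N : theta (orbit_product p c z) = coord_x ^+ (p ^ 3) * nu.
Proof.
rewrite orbit_productE rmorph_prod /= /nu.
under eq_bigr do rewrite theta_translate // theta_z rmorphM /= shift_x.
rewrite big_split /= prodr_const; congr (_ ^+ _ * _).
by rewrite -size_translations size_map -cardE.
Qed.

(** $f_3/x^{p^2+2}$ as a polynomial in $f_1/x^{2p}$: the second relation divided by $x^{2p^2}$ and
    solved for $f_3$. *)
Definition phi3_poly : E :=
  scal (- 2)^-1 * ('X^p + scal (gam 1 2 3 ^+ (p - 2)) * coord_s ^+ 2
    + scal (2 * (- gam 1 2 3) ^+ ((p - 3) %/ 2) * gam 1 2 5) * 'X^((p + 1) %/ 2)).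

Lemma phi3_degree : unit_degree p phi3_poly.
Proof.
apply: unit_degreeZ.
  by rewrite iota_unit ?invr_eq0 ?oppr_eq0 ?(two_neq0 p_gt2 charF).
rewrite -addrA; apply: unit_degreeDl; first exact: unit_degreeXn.
apply: leq_trans (size_polyD _ _) _; rewrite geq_max.
rewrite !size_scalM ?size_polyXn //; first by lia.
by rewrite -polyC_exp (leq_trans (size_polyC_leq1 _)) // prime_gt0.
Qed.

Lemma theta_f3 : xD != 0 -> theta (f3 p c) = coord_x ^+ (p ^ 2 + 2) * (phi3_poly \Po phi1).
Proof.
move=> xD_neq0; have lt2p := p2_gt2p p_gt2.
have n2 : - 2 != 0 :> F by rewrite oppr_eq0 (two_neq0 p_gt2 charF).
have coord_x_neq0 : coord_x != 0 by rewrite polyC_eq0.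
have [_ [_]] := f3E c p_gt2 p_prime charF => /(congr1 theta).
rewrite thetaZ rmorphM rmorphXn /= theta_x => Ef3.
(* Multiplying by $-2x^{p^2-2}$ turns $f_3$ into its numerator, each summand of which carries
   $x^{2p^2}$. *)
apply: (mulfI (_ : scal (- 2) * coord_x ^+ (p ^ 2 - 2) != 0)).
  by rewrite mulf_neq0 ?expf_neq0 // polyC_eq0 fmorph_eq0.
rewrite -mulrA -Ef3 /f3_numerator /phi3_poly.
move: (gam 1 2 3 ^+ (p - 2)) (2 * _ * gam 1 2 5) => cA cB.
rewrite !rmorphD /= !thetaZ !rmorphXn rmorphM /= !rmorphXn /= theta_f1 // theta_f2 // theta_x.
have scalC a : scal a \Po phi1 = scal a by exact: comp_polyC.
have sC : coord_s \Po phi1 = coord_s by exact: comp_polyC.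
rewrite (comp_polyM (scal _)) !comp_polyD (comp_polyM (scal cA)) (comp_polyM (scal cB)).
rewrite !rmorphXn /= !comp_polyX !scalC sC {scalC sC}.
move: phi1 coord_s => f s.
have -> : (coord_x ^+ (2 * p) * f) ^+ p = coord_x ^+ (p ^ 2 - 2) * coord_x ^+ (p ^ 2 + 2) * f ^+ p.
  by rewrite exprMn -exprM -exprD; congr (_ ^+ _ * _); rewrite -mulnn; lia.
have -> : (coord_x ^+ (p ^ 2) * s) ^+ 2 = coord_x ^+ (p ^ 2 - 2) * coord_x ^+ (p ^ 2 + 2) * s ^+ 2.
  by rewrite [LHS]exprMn -exprM -exprD; congr (_ ^+ _ * _); lia.
have -> : coord_x ^+ (p ^ 2 - p) * (coord_x ^+ (2 * p) * f) ^+ ((p + 1) %/ 2) =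
   coord_x ^+ (p ^ 2 - 2) * coord_x ^+ (p ^ 2 + 2) * f ^+ ((p + 1) %/ 2).
  rewrite [_ ^+ ((p + 1) %/ 2)]exprMn mulrA -exprM -!exprD; congr (_ ^+ _ * _).
  have p_odd : odd p by case/even_prime: p_prime p_gt2 => [->|].
  have -> : (2 * p * ((p + 1) %/ 2) = p * (p + 1))%N.
    by rewrite mulnAC mulnC [(2 * _)%N]mulnC divnK // addn1 dvdn2 /= p_odd.
  by rewrite mulnDr muln1; move: lt2p; rewrite -mulnn; lia.
have s2 : scal (- 2) * scal (- 2)^-1 = 1 by rewrite -rmorphM mulfV // rmorph1.
rewrite [RHS](_ : _ = scal (- 2) * scal (- 2)^-1 * (coord_x ^+ (p ^ 2 - 2) * coord_x ^+ (p ^ 2 + 2) *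
 (f ^+ p + scal cA * s ^+ 2 + scal cB * f ^+ ((p + 1) %/ 2)))); last by ring.
by rewrite s2; ring.
Qed.

End Degrees.

(** * Invariants up to a power of x *)

(** With $s=f_2/X^{p^2}$, the formula that defines [coord_delta] does recover $\delta/X^2$ in a
    field. *)
Lemma delta_fraction (L : fieldType) p (X Y d a b e h : L) : (2 < p)%N -> X != 0 ->
  a * (Y / X) ^+ (p ^ 2) - b * (Y / X) ^+ p - h * (Y / X)
    - (a * Y ^+ (p ^ 2) - b * (Y ^+ p * X ^+ (p ^ 2 - p))
       - X ^+ (p ^ 2 - 2) * (e * d + h * (Y * X))) / X ^+ (p ^ 2)
  = e * (d / X ^+ 2).
Proof.
move=> p_gt2 X0; have lt2p := p2_gt2p p_gt2; rewrite !expr_div_n.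
have Xr : X ^+ (p ^ 2 - p) = X ^+ (p ^ 2) / X ^+ p.
  by apply: (mulIf (expf_neq0 p X0)); rewrite divfK ?expf_neq0 // -exprD; congr (_ ^+ _); lia.
have Xt : X ^+ (p ^ 2) = X ^+ (p ^ 2 - 2) * X ^+ 2.
  by rewrite -exprD; congr (_ ^+ _); lia.
rewrite Xr Xt; have Xp0 := expf_neq0 p X0; have Xt0 := expf_neq0 (p ^ 2 - 2) X0.
move: (X ^+ p) Xp0 (X ^+ (p ^ 2 - 2)) Xt0 (Y ^+ p) (Y ^+ (p ^ 2)) => Xp Xp0 t t0 Yp Y2.
by field; rewrite X0 t0 Xp0.
Qed.

Section Span.
Variables (p : nat) (F : fieldType) (c : 'M[F]_(2, 3)).
Hypotheses (p_prime : prime p) (p_gt2 : (2 < p)%N) (charF : p \in [pchar F]).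
Hypotheses (g123 : gamma p c 1 2 3 != 0) (g135 : gamma p c 1 3 5 != 0).

Local Notation x := ('X_(inord 0) : {mpoly F[3]}).
Local Notation y := ('X_(inord 1) : {mpoly F[3]}).
Local Notation z := ('X_(inord 2) : {mpoly F[3]}).
Local Notation R := {mpoly F[3]}.
Local Notation gam := (gamma p c).

Section InvariantSpan.
Variables (D : idomainType) (iota : {rmorphism F -> D}) (xD sD : D).

Local Notation E := {poly D}.
Local Notation scal := (scal iota).
Local Notation coord_x := (coord_x xD).
Local Notation coord_s := (coord_s sD).
Local Notation coord_delta := (coord_delta p c iota sD).
Local Notation coord_z := (coord_z p c iota sD).
Local Notation phi1 := (phi1 p c iota sD).
Local Notation phi3_poly := (phi3_poly p c iota sD).
Local Notation nu := (nu p c iota sD).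
Local Notation theta := (theta p c iota xD sD).
Local Notation shift := (@shift p F c D iota).

(** Sending $Y$ to $y/x$ and $s$ to $f_2/x^{p^2}$ undoes the change of coordinates. With [L] the
    fraction field, this will give the injectivity of [theta]. *)
Lemma theta_retraction (L : fieldType) (j : {rmorphism R -> L}) (k : {rmorphism E -> L}) :
    j x != 0 -> (forall a, k (scal a) = j a%:MP) -> k coord_x = j x ->
    k 'X = j y / j x -> k coord_s = j (f2 p c) / j x ^+ (p ^ 2) ->
  forall q, k (theta q) = j q.
Proof.
move=> jx0 kscal kx kX ks q.
have kd : k coord_delta = j (delta F) / j x ^+ 2.
  have := f2E c p_gt2; rewrite /f3_head; move: (delta F) => d f2d.
  have n0 : k (scal (gam 1 3 5)) != 0.
    by rewrite kscal (fmorph_eq0 (j \o @mpolyC 3 F : {rmorphism F -> L})).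
  apply: (mulfI n0); rewrite -rmorphM scal_delta // !rmorphB !rmorphM !rmorphXn /=.
  rewrite kX ks !kscal f2d.
  rewrite !rmorphB !rmorphM !rmorphD !rmorphM !rmorphXn /=.
  exact: delta_fraction.
pose kt : {rmorphism R -> L} := k \o theta.
suff eqj : kt =1 j by exact: eqj.
apply: mpoly_rmorph_ext => [a|i]; first by rewrite /= thetaC kscal.
have -> : i = inord i by apply/val_inj; rewrite /= inordK.
case: i => [[|[|[|]]]] //= _.
- by rewrite theta_x kx.
- by rewrite theta_y rmorphM /= kx kX mulrC divfK.
rewrite theta_z rmorphM /= kx /coord_z rmorphB rmorphXn /= kX kd.
rewrite /delta rmorphB rmorphXn rmorphM /=.
move: (j x) jx0 (j y) (j z) => X X0 Y Z.
by field.
Qed.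

Hypothesis xD_neq0 : xD != 0.
Hypothesis theta_inj : injective theta.
Hypothesis D_ind : forall P : D -> Prop,
  (forall a, P (iota a)) -> (forall d1 d2, P d1 -> P d2 -> P (d1 + d2)) ->
  (forall d, P d -> P (xD * d)) -> (forall d, P d -> P (sD * d)) -> forall d, P d.

Lemma invariantP q : G_invariant p c q <-> forall g, shift g (theta q) = theta q.
Proof.
split=> invq g; first by rewrite -theta_translate // -group_actE // invq.
by apply: theta_inj; rewrite group_actE // theta_translate.
Qed.

Lemma generators_invariant i : G_invariant p c (tnth (generators p c) i).
Proof.
apply/invariantP => g; rewrite (tnth_nth 0); case: i => [[|[|[|[|[|]]]]]] //= _.
- by rewrite theta_x shift_x.
- by rewrite theta_f1 // rmorphM rmorphXn /= shift_x shift_phi1.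
- by rewrite theta_f2 // rmorphM rmorphXn /= shift_x shift_s.
- rewrite theta_f3 // rmorphM rmorphXn /= shift_x; congr (_ * _).
  by rewrite shift_comp_poly shift_phi1.
by rewrite theta_N // rmorphM rmorphXn /= shift_x shift_nu.
Qed.

Local Notation B := (generators p c).
Local Notation T i := ('X_(inord i) : {mpoly F[5]}).

(** Indices 1 and 3 stand for $f_1$ and $f_3$, whose $p$-th powers the two relations rewrite. *)
Definition normal (Q : {mpoly F[5]}) :=
  forall I, Q@_I != 0 -> (I (inord 1) < p)%N && (I (inord 3) < p)%N.

Lemma normal0 : normal 0.
Proof. by move=> I; rewrite mcoeff0 eqxx. Qed.

Lemma normalD Q1 Q2 : normal Q1 -> normal Q2 -> normal (Q1 + Q2).
Proof.
move=> n1 n2 I; rewrite mcoeffD.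
by have [->|/n1 //] := eqVneq Q1@_I 0; rewrite add0r => /n2.
Qed.

Lemma normalZ a Q : normal Q -> normal (a *: Q).
Proof. by move=> nQ I; rewrite mcoeffZ mulf_eq0 negb_or => /andP[_ /nQ]. Qed.

Lemma normalXm (I : 'X_{1..5}) : (I (inord 1) < p)%N -> (I (inord 3) < p)%N -> normal 'X_[I].
Proof.
move=> lt1 lt3 J; rewrite mcoeffX; case: (I =P J) => [<- _|_]; rewrite ?lt1 ?eqxx //.
Qed.

Lemma normal_mulX (i : 'I_5) k Q : i != inord 1 -> i != inord 3 ->
  normal Q -> normal ('X_i ^+ k * Q).
Proof.
move=> ne1 ne3 nQ I; rewrite -mcoeff_msupp mulrC mpolyXn (perm_mem (msuppMX _ _)).
case/mapP=> J; rewrite mcoeff_msupp => /nQ lt_J ->.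
by rewrite !mnmDE !mulmnE !mnm1E (negPf ne1) (negPf ne3).
Qed.

(** The power of $x$ is left free, so that these elements are closed under addition and under
    multiplication by $x$ and by $s$. *)
Definition spanned (h : E) :=
  exists M Q, normal Q /\ coord_x ^+ M * h = theta (Q \mPo B).

Lemma inord5 i j : (i < 5)%N -> (j < 5)%N -> ((inord i : 'I_5) == inord j) = (i == j).
Proof. by move=> lti ltj; rewrite -val_eqE /= !inordK. Qed.

Lemma comp_T i : (i < 5)%N -> T i \mPo B = nth 0 [:: x; f1 p c; f2 p c; f3 p c; orbit_product p c z] i.
Proof. by move=> lti; rewrite comp_mpolyXU inordK. Qed.

Lemma spannedD h1 h2 : spanned h1 -> spanned h2 -> spanned (h1 + h2).
Proof.
case=> M1 [Q1 [n1 e1]] [M2 [Q2 [n2 e2]]].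
exists (M1 + M2)%N, (T 0 ^+ M2 * Q1 + T 0 ^+ M1 * Q2); split.
  by apply: normalD; apply: normal_mulX; rewrite ?inord5.
rewrite comp_mpolyD !rmorphM /= !rmorphXn /= comp_T //= rmorphD !rmorphM !rmorphXn /=.
by rewrite theta_x -e1 -e2 exprD; ring.
Qed.

Lemma spanned0 : spanned 0.
Proof. by exists 0%N, 0; split; [exact: normal0|rewrite comp_mpoly0 mulr0 rmorph0]. Qed.

Lemma spanned_scal a h : spanned h -> spanned (scal a * h).
Proof.
case=> M [Q [n e]]; exists M, (a *: Q); split; first exact: normalZ.
by rewrite comp_mpolyZ thetaZ -e mulrCA.
Qed.

Lemma spanned_x h : spanned h -> spanned (coord_x * h).
Proof.
case=> M [Q [n e]]; exists M, (T 0 ^+ 1 * Q); split.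
  by apply: normal_mulX; rewrite ?inord5.
by rewrite expr1 rmorphM /= comp_T //= rmorphM /= theta_x -e mulrCA.
Qed.

Lemma spanned_s h : spanned h -> spanned (coord_s * h).
Proof.
case=> M [Q [n e]]; exists (p ^ 2 + M)%N, (T 2 ^+ 1 * Q); split.
  by apply: normal_mulX; rewrite ?inord5.
by rewrite expr1 rmorphM /= comp_T //= rmorphM /= theta_f2 // -e exprD; ring.
Qed.

Lemma spanned_coef (d : D) h : spanned h -> spanned (d%:P * h).
Proof.
move=> gh; elim/D_ind: d => [a|d1 d2 IH1 IH2|d IHd|d IHd].
- exact: spanned_scal.
- by rewrite polyCD mulrDl; apply: spannedD.
- by rewrite polyCM -mulrA; apply: spanned_x.
by rewrite polyCM -mulrA; apply: spanned_s.
Qed.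

Lemma spanned_basis l k i : (k < p)%N -> (i < p)%N ->
  spanned (nu ^+ l * (phi3_poly \Po phi1) ^+ k * phi1 ^+ i).
Proof.
have := theta_f3 p_prime p_gt2 charF g123 g135 iota sD xD_neq0.
(* The exponent sums the powers of $x$ that [theta] extracts from $N_G(z)^l$, $f_3^k$ and
   $f_1^i$. *)
move: (_ \Po _) => f theta_f ltk lti; exists (p ^ 3 * l + (p ^ 2 + 2) * k + 2 * p * i)%N.
exists ('X_[U_(inord 4) *+ l + U_(inord 3) *+ k + U_(inord 1) *+ i]); split.
  by apply: normalXm; rewrite !mnmDE !mulmnE !mnm1E !inord5 //= ?mul1n ?mul0n ?addn0 ?add0n.
rewrite !mpolyXD -!mpolyXn !rmorphM /= !rmorphXn /= !comp_T //=.
rewrite ?rmorphM ?rmorphXn /= theta_N // theta_f theta_f1 //.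
move: phi1 nu coord_x => h n X.
rewrite [(_ * n) ^+ l]exprMn [(_ * f) ^+ k]exprMn [(_ * h) ^+ i]exprMn -![X ^+ _ ^+ _]exprM.
rewrite (exprD X (_ * _ + _)%N) (exprD X (_ * _)%N).
by move: (X ^+ _) (X ^+ _) (X ^+ _) (n ^+ l) (f ^+ k) (h ^+ i) => *; ring.
Qed.

(** Writing $n=p^2l+pk+i$ with $i,k<p$ yields one polynomial of each degree $n$, whose value at
    [phi1] is a normal monomial up to a power of $x$. *)
Lemma spanned_comp H : spanned (H \Po phi1).
Proof.
have p_gt0 := prime_gt0 p_prime.
have inv_nu g : shift g nu = nu by exact: shift_nu.
have [Hnu def_nu] := shift_invariant_comp p_prime p_gt2 charF g123 g135 sD inv_nu.
have deg_phi1 : unit_degree (p ^ 3) phi1 by exact: phi1_degree.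
(* [nu] has degree $p^5$ and [phi1] has degree $p^3$. *)
have deg_nu : unit_degree (p ^ 2) Hnu.
  apply: unit_degree_comp_inv deg_phi1; first by rewrite expn_gt0 p_gt0.
  by rewrite -def_nu; exact: nu_degree.
have deg_phi3 : unit_degree p phi3_poly by exact: phi3_degree.
pose b n := Hnu ^+ (n %/ p ^ 2) * phi3_poly ^+ (n %% p ^ 2 %/ p) * 'X^(n %% p).
have deg_b n : unit_degree n (b n).
  have def_n : (p ^ 2 * (n %/ p ^ 2) + p * (n %% p ^ 2 %/ p) + n %% p = n)%N.
    rewrite -(modn_dvdm n (dvdn_exp (isT : 0 < 2)%N (dvdnn p))) -addnA.
    by rewrite !(mulnC _ (_ %/ _)%N) -!divn_eq.
  rewrite -[X in unit_degree X]def_n; apply: unit_degreeM (unit_degreeXn _ _).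
  by apply: unit_degreeM; apply: unit_degreeX.
apply: (@poly_basis_ind D (fun H => spanned (H \Po phi1)) b _ _ _ _ _ H) => [n|n||h1 h2 IH1 IH2|n d].
- by case: (deg_b n).
- by case: (deg_b n).
- by rewrite comp_poly0; apply: spanned0.
- by rewrite comp_polyD; apply: spannedD.
rewrite comp_polyZ -mul_polyC; apply: spanned_coef.
rewrite !comp_polyM !rmorphXn /= comp_polyX -def_nu.
apply: spanned_basis; last by rewrite ltn_mod.
by rewrite ltn_divLR // mulnn ltn_mod expn_gt0 p_gt0.
Qed.

Lemma invariant_good q : G_invariant p c q ->
  exists M Q, normal Q /\ x ^+ M * q = Q \mPo B.
Proof.
move/invariantP=> invq.
have [H def_q] := shift_invariant_comp p_prime p_gt2 charF g123 g135 sD invq.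
have [M [Q [nQ eqQ]]] := spanned_comp H.
exists M, Q; split=> //; apply: theta_inj.
by rewrite -eqQ -def_q rmorphM rmorphXn /= theta_x.
Qed.

End InvariantSpan.

End Span.

(** * The coordinate ring made concrete *)

Section Normalization.
Variables (p : nat) (F : fieldType) (c : 'M[F]_(2, 3)).
Hypotheses (p_prime : prime p) (p_gt2 : (2 < p)%N) (charF : p \in [pchar F]).
Hypotheses (g123 : gamma p c 1 2 3 != 0) (g135 : gamma p c 1 3 5 != 0).

Local Notation x := ('X_(inord 0) : {mpoly F[3]}).
Local Notation y := ('X_(inord 1) : {mpoly F[3]}).
Local Notation R := {mpoly F[3]}.

Local Notation D := {poly {poly F}}.
Local Notation B := (generators p c).

(** [D] becomes $\mathbf F[s][x]$: the outer variable ['X] is $x$ and the inner one, ['X%:P], is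
    $s$. *)
Definition iota2 : {rmorphism F -> D} := polyC \o polyC.

Local Notation theta2 := (theta p c iota2 'X 'X%:P).

Lemma theta2_inj : injective theta2.
Proof.
pose j : {rmorphism R -> {fraction R}} := @tofrac R.
have jx : j x != 0 by rewrite /= tofrac_eq0 -msize_poly_eq0 msizeX.
pose j0 : {rmorphism F -> {fraction R}} := j \o @mpolyC 3 F.
(* One variable at a time: $s\mapsto f_2/x^{p^2}$, then $x\mapsto x$, then $Y\mapsto y/x$. *)
pose k1 : {rmorphism {poly F} -> {fraction R}} :=
  horner_morph (fun a => mulrC (j (f2 p c) / j x ^+ (p ^ 2)) (j0 a)).
pose k2 : {rmorphism D -> {fraction R}} := horner_morph (fun a => mulrC (j x) (k1 a)).
pose k : {rmorphism {poly D} -> {fraction R}} :=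
  horner_morph (fun a => mulrC (j y / j x) (k2 a)).
have retr : forall q, k (theta2 q) = j q.
  apply: theta_retraction => //.
  - by move=> a; do 3!rewrite [LHS]horner_morphC.
  - by rewrite [LHS]horner_morphC [LHS]horner_morphX.
  - by rewrite [LHS]horner_morphX.
  by do 2!rewrite [LHS]horner_morphC; rewrite [LHS]horner_morphX.
move=> q1 q2 /(congr1 k); rewrite !retr => /eqP.
by rewrite -subr_eq0 -rmorphB /= tofrac_eq0 subr_eq0 => /eqP.
Qed.

Lemma poly2_ind (P : D -> Prop) :
  (forall a, P (iota2 a)) -> (forall d1 d2, P d1 -> P d2 -> P (d1 + d2)) ->
  (forall d, P d -> P ('X * d)) -> (forall d, P d -> P ('X%:P * d)) -> forall d, P d.
Proof.
move=> Pa PD Px Ps; elim/poly_ind => [|d e IHd]; first by rewrite -(rmorph0 iota2).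
apply: (PD); first by rewrite mulrC; apply: (Px).
elim/poly_ind: e => [|e a IHe]; first by rewrite polyC0 -(rmorph0 iota2).
by rewrite polyCD polyCM; apply: (PD); [rewrite mulrC; apply: (Ps)|apply: (Pa)].
Qed.

Lemma poly2_X_neq0 : 'X != 0 :> D. Proof. by rewrite polyX_eq0. Qed.

Lemma generator_invariant i : G_invariant p c (tnth B i).
Proof. exact: (generators_invariant p_prime p_gt2 charF g123 g135 poly2_X_neq0 theta2_inj). Qed.

Lemma invariant_normal q : G_invariant p c q ->
  exists M Q, normal p Q /\ x ^+ M * q = Q \mPo B.
Proof.
exact: (invariant_good p_prime p_gt2 charF g123 g135 poly2_X_neq0 theta2_inj poly2_ind).
Qed.

End Normalization.

(** * Lead monomials of the generators and normal forms *)

Section DegreeBound.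
Variables (F : fieldType) (n : nat).
Implicit Types q : {mpoly F[n]}.

Definition degree_le q d := forall m, q@_m != 0 -> (mdeg m <= d)%N.

Lemma degree_leW q d e : degree_le q d -> (d <= e)%N -> degree_le q e.
Proof. by move=> qd lede m /qd/leq_trans; apply. Qed.

Lemma degree_leD q1 q2 d : degree_le q1 d -> degree_le q2 d -> degree_le (q1 + q2) d.
Proof.
move=> d1 d2 m; rewrite mcoeffD.
by have [->|/d1 //] := eqVneq q1@_m 0; rewrite add0r => /d2.
Qed.

Lemma degree_leZ a q d : degree_le q d -> degree_le (a *: q) d.
Proof. by move=> qd m; rewrite mcoeffZ mulf_eq0 negb_or => /andP[_ /qd]. Qed.

Lemma degree_leN q d : degree_le q d -> degree_le (- q) d.
Proof. by move=> qd m; rewrite mcoeffN oppr_eq0 => /qd. Qed.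

Lemma degree_leM q1 q2 d1 d2 :
  degree_le q1 d1 -> degree_le q2 d2 -> degree_le (q1 * q2) (d1 + d2).
Proof.
move=> le1 le2 m; rewrite -mcoeff_msupp => /msuppM_le/allpairsP[[u v] /= [+ + ->]].
by rewrite !mcoeff_msupp mdegD => /le1 ? /le2 ?; apply: leq_add.
Qed.

Lemma degree_leXn q d k : degree_le q d -> degree_le (q ^+ k) (d * k).
Proof.
move=> qd; elim: k => [|k IHk]; last by rewrite exprS mulnS; apply: degree_leM.
by move=> m; rewrite expr0 mcoeff1; case: (m =P _) => [->|_]; rewrite ?mdeg0 ?eqxx.
Qed.

Lemma degree_leX i : degree_le 'X_i 1.
Proof.
by move=> m; rewrite mcoeffX; case: (_ =P m) => [<-|_]; rewrite ?mdeg1 ?eqxx.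
Qed.

Lemma degree_leXni i k : degree_le ('X_i ^+ k) k.
Proof. by rewrite -[k in degree_le _ k]mul1n; apply/degree_leXn/degree_leX. Qed.

End DegreeBound.

Section GeneratorLeads.
Variables (p : nat) (F : fieldType) (c : 'M[F]_(2, 3)).
Hypotheses (p_prime : prime p) (p_gt2 : (2 < p)%N) (charF : p \in [pchar F]).
Hypotheses (g123 : gamma p c 1 2 3 != 0) (g135 : gamma p c 1 3 5 != 0).

Local Notation x := ('X_(inord 0) : {mpoly F[3]}).
Local Notation y := ('X_(inord 1) : {mpoly F[3]}).
Local Notation z := ('X_(inord 2) : {mpoly F[3]}).
Local Notation G := 'rV['Z_p]_3.
Local Notation R := {mpoly F[3]}.
Local Notation gam := (gamma p c).

Definition mod_x : R -> R := comp_mpoly [tuple 0; y; z].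
HB.instance Definition _ := GRing.RMorphism.copy mod_x (comp_mpoly [tuple 0; y; z]).

Lemma mod_xZ a q : mod_x (a *: q) = a *: mod_x q. Proof. exact: comp_mpolyZ. Qed.

Lemma mod_x_coef q (m : 'X_{1..3}) : (mod_x q)@_m = if m (inord 0) == 0%N then q@_m else 0.
Proof.
have [i0 i1 i2] : [/\ ord0 = inord 0 :> 'I_3, lift ord0 ord0 = inord 1 :> 'I_3
   & lift ord0 (lift ord0 ord0) = inord 2 :> 'I_3].
  by split; apply/val_inj; rewrite /= inordK.
have mod_X (m' : 'X_{1..3}) : mod_x 'X_[m'] = if m' (inord 0) == 0%N then 'X_[m'] else 0.
  rewrite /mod_x comp_mpolyX !big_ord_recl big_ord0 !(tnth_nth 0) /= i2 i1 i0 mulr1.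
  rewrite [in RHS]mpolyXE_id !big_ord_recl big_ord0 /= i2 i1 i0 mulr1 expr0n.
  by case: eqP => [->|_]; rewrite ?mul0r // expr0.
rewrite [mod_x q]comp_mpolyEX raddf_sum /=.
under eq_bigr => m' _ do rewrite -/(mod_x _) mcoeffZ mod_X.
case: ifP => m0; last first.
  rewrite big1 // => m' _; case: ifP => m'0; rewrite ?mcoeff0 ?mulr0 //.
  by rewrite mcoeffX; case: eqP => [eqm|]; rewrite ?mulr0 //; rewrite eqm m0 in m'0.
rewrite [in RHS](mpolyE q) [RHS]raddf_sum /=; apply: eq_bigr => m' _; rewrite mcoeffZ.
case: ifP => // m'0; rewrite mcoeff0 mcoeffX.
by case: eqP => // eqm; rewrite eqm m0 in m'0.
Qed.

Lemma mod_x_x : mod_x x = 0. Proof. by rewrite /mod_x comp_mpolyXU inordK. Qed.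
Lemma mod_x_y : mod_x y = y. Proof. by rewrite /mod_x comp_mpolyXU inordK. Qed.
Lemma mod_x_C a : mod_x a%:MP = a%:MP. Proof. exact: comp_mpolyC. Qed.

(** In degree at most $d$, every monomial involving $x$ is below $y^d$: its degree is smaller, or
    its exponent of $x$ is larger. The other monomials are read off modulo $x$. *)
Lemma is_lead_y q d a : degree_le q d -> mod_x q = a *: y ^+ d -> a != 0 ->
  is_lead q (U_(inord 1) *+ d).
Proof.
move=> qd modq a0; have coefq (m : 'X_{1..3}) : m (inord 0) = 0%N ->
    q@_m = a * ((U_(inord 1) *+ d)%MM == m)%:R.
  by move=> m0; have := mod_x_coef q m; rewrite m0 eqxx modq mcoeffZ mcoeffXn.
have y0 : (U_(inord 1) *+ d)%MM (inord 0 : 'I_3) = 0%N.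
  by rewrite mulmnE mnm1E -val_eqE /= !inordK.
split; first by rewrite coefq // eqxx mulr1.
move=> m qm; have [m0|m_gt0] := posnP (m (inord 0)).
  move: qm; rewrite coefq //; case: (_ =P m) => [<- _|_]; first exact: grevlex_le_refl.
  by rewrite mulr0 eqxx.
have := qd m qm; rewrite leq_eqVlt => /predU1P[eqd|ltd]; apply/grevlex_ltW/grevlex_ltP.
  right; split; first by rewrite eqd mdegMn mdeg1 mul1n.
  exists (inord 0); first by rewrite y0.
  by move=> j; rewrite inordK.
by left; rewrite mdegMn mdeg1 mul1n.
Qed.

Lemma delta_degree : degree_le (delta F) 2.
Proof.
apply: degree_leD; first exact: degree_leXni.
by apply/degree_leN/(@degree_leM _ _ _ _ 1 1); apply: degree_leX.
Qed.

Lemma mod_x_delta : mod_x (delta F) = y ^+ 2.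
Proof. by rewrite /delta rmorphB rmorphXn rmorphM /= mod_x_x mod_x_y mul0r subr0. Qed.

Lemma f1_degree : degree_le (f1 p c) (2 * p).
Proof.
rewrite /f1 -!scaleNr; repeat apply: degree_leD; apply: degree_leZ.
- by apply: degree_leXn; exact: delta_degree.
- rewrite mul2n -addnn; apply: degree_leM; exact: degree_leXni.
- apply: degree_leW (degree_leM (@delta_degree) (@degree_leXni _ _ _ _)) _; lia.
- apply: degree_leW (degree_leM (@degree_leX _ _ _) (@degree_leXni _ _ _ _)) _; lia.
Qed.

Lemma f2_degree : degree_le (f2 p c) (p ^ 2).
Proof.
have lt2p := p2_gt2p p_gt2.
rewrite /f2 -!scaleNr; repeat apply: degree_leD; apply: degree_leZ.
- exact: degree_leXni.
- apply: degree_leW (degree_leM (@degree_leXni _ _ _ _) (@degree_leXni _ _ _ _)) _; lia.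
- apply: degree_leW (degree_leM (@delta_degree) (@degree_leXni _ _ _ _)) _; lia.
- apply: degree_leW (degree_leM (@degree_leX _ _ _) (@degree_leXni _ _ _ _)) _; lia.
Qed.

(** The numerator has degree at most $2p^2$, and $x^{p^2-2}$ divides out exactly. *)
Lemma f3_degree : degree_le (f3 p c) (p ^ 2 + 2).
Proof.
have lt2p := p2_gt2p p_gt2; have pp : (p ^ 2 = p * p)%N by rewrite mulnn.
have num : degree_le (f3_numerator p c) (2 * p ^ 2).
  repeat apply: degree_leD; repeat apply: degree_leZ.
  - apply: degree_leW (degree_leXn (@f1_degree)) _; lia.
  - apply: degree_leW (degree_leXn (@f2_degree)) _; lia.
  apply: degree_leW (degree_leM (@degree_leXni _ _ _ _) (degree_leXn (@f1_degree))) _.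
  have : (2 * ((p + 1) %/ 2) <= p + 1)%N by rewrite mulnC leq_trunc_div.
  nia.
have [_ [_ eqn]] := f3E c p_gt2 p_prime charF.
move=> m fm; have := num (U_(inord 0) *+ (p ^ 2 - 2) + m)%MM.
rewrite eqn mcoeffZ mpolyXn ['X_[_] * _]mulrC mcoeffMX mdegD mdegMn mdeg1 mul1n.
rewrite mulf_neq0 ?oppr_eq0 ?(two_neq0 p_gt2 charF) // => /(_ isT); lia.
Qed.

Lemma mod_x_f1 : mod_x (f1 p c) = - gam 1 2 3 *: y ^+ (2 * p).
Proof.
rewrite (f1E c p_gt2) rmorphB rmorphN !rmorphM !rmorphXn /= mod_x_x mod_x_C mod_x_delta.
by rewrite expr0n gtn_eqF ?prime_gt0 // mul0r subr0 -exprM mul_mpolyC scaleNr.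
Qed.

Lemma mod_x_f2 : mod_x (f2 p c) = gam 1 2 3 *: y ^+ (p ^ 2).
Proof.
have lt2p := p2_gt2p p_gt2.
rewrite (f2E c p_gt2) !rmorphB !rmorphM !rmorphXn /= mod_x_x mod_x_C mod_x_y.
rewrite !expr0n !gtn_eqF; try lia.
by rewrite !mulr0 mul0r !subr0 mul_mpolyC.
Qed.

Lemma mod_x_f3 : mod_x (f3 p c) = (gam 1 2 3 ^+ (p - 1) * gam 1 3 5) *: y ^+ (p ^ 2 + 2).
Proof.
have [W [-> _]] := f3E c p_gt2 p_prime charF; rewrite /f3_head.
move: (delta F) mod_x_delta => d mod_d.
rewrite rmorphD !rmorphM rmorphD !rmorphM !rmorphXn /= !mod_x_C mod_d mod_x_x mod_x_y.
rewrite mulr0 mul0r !addr0 mulr0 addr0 exprD -!mul_mpolyC !rmorphM rmorphXn /=; ring.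
Qed.

(** Each of the $p^3$ conjugates of $z$ is $z$ plus a combination of $x$ and $y$, hence has lead
    monomial $z$. *)
Lemma N_lead : is_lead (orbit_product p c z) (U_(inord 2) *+ p ^ 3).
Proof.
have lead_z (g : G) : is_lead (translate c g z) U_(inord 2).
  rewrite /translate comp_mpolyXU inordK //=; split.
    rewrite !(mcoeffD, mcoeffZ) !mcoeffX !eq_mnm1 -!val_eqE /= !inordK //=.
    by rewrite !mulr0 !addr0 oner_neq0.
  have bnd j : bounded ('X_j : R) U_(inord 2).
    move=> m; rewrite mcoeffX; case: (_ =P m) => [<- _|_]; last by rewrite eqxx.
    rewrite /grevlex_le; case: eqVneq => //= ne; apply/grevlex_ltP; right.
    rewrite !mdeg1; split=> //; exists j => [|k ltkj]; rewrite !mnm1E.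
      by rewrite eqxx eq_sym -eq_mnm1 (negPf ne).
    rewrite -!val_eqE /= inordK // !gtn_eqF //.
    by rewrite (leq_trans ltkj) // -ltnS ltn_ord.
  by repeat (apply: boundedD || apply: boundedZ).
rewrite orbit_productE //.
have := is_lead_prod (r := index_enum G) (fun (g : G) _ => lead_z g).
congr (is_lead _ _).
have -> : (p ^ 3)%N = size (index_enum G).
  transitivity (size (enum G)); last by rewrite enumT.
  by rewrite -cardE card_mx mul1n card_ord Zp_cast ?prime_gt1.
elim: (index_enum G) => [|g r IHr]; first by rewrite big_nil mulm0n.
by rewrite big_cons mulmS IHr.
Qed.

End GeneratorLeads.

(** * Normal combinations of the generators *)

Section NormalForms.
Variables (p : nat) (F : fieldType) (c : 'M[F]_(2, 3)).
Hypotheses (p_prime : prime p) (p_gt2 : (2 < p)%N) (charF : p \in [pchar F]).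
Hypotheses (g123 : gamma p c 1 2 3 != 0) (g135 : gamma p c 1 3 5 != 0).

Local Notation x := ('X_(inord 0) : {mpoly F[3]}).
Local Notation R := {mpoly F[3]}.

Local Notation B := (generators p c).
Local Notation T i := ('X_(inord i) : {mpoly F[5]}).
Local Notation normal := (normal p).
Local Notation mod_x := (@mod_x F).

Definition generator_lead (i : 'I_5) : 'X_{1..3} :=
  nth 0%MM [:: U_(inord 0); U_(inord 1) *+ (2 * p); U_(inord 1) *+ (p ^ 2);
    U_(inord 1) *+ (p ^ 2 + 2); U_(inord 2) *+ (p ^ 3)]%MM i.

Lemma generators_lead i : is_lead (tnth B i) (generator_lead i).
Proof.
rewrite (tnth_nth 0) /generator_lead; case: i => [[|[|[|[|[|]]]]]] //= _.
- exact: is_leadXm.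
- apply: is_lead_y; [exact: f1_degree|exact: mod_x_f1|by rewrite oppr_eq0].
- by apply: is_lead_y; [exact: f2_degree|exact: mod_x_f2|].
- apply: is_lead_y; [exact: f3_degree|exact: mod_x_f3|].
  by rewrite mulf_neq0 ?expf_neq0.
exact: N_lead.
Qed.

Definition lead_exp (I : 'X_{1..5}) : 'X_{1..3} :=
  (\big[+%MM/0%MM]_(i < 5) (generator_lead i *+ I i))%MM.

Lemma monomial_lead I : is_lead ('X_[I] \mPo B) (lead_exp I).
Proof.
rewrite comp_mpolyX; apply: is_lead_prod => i _; apply: is_leadXn.
exact: generators_lead.
Qed.

Lemma lead_expE I : [/\ lead_exp I (inord 0) = I (inord 0),
    lead_exp I (inord 1) = (2 * p * I (inord 1) + p ^ 2 * I (inord 2) + (p ^ 2 + 2) * I (inord 3))%N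
  & lead_exp I (inord 2) = (p ^ 3 * I (inord 4))%N].
Proof.
have lead_expI j : lead_exp I j = (\sum_(i < 5) generator_lead i j * I i)%N.
  by rewrite /lead_exp mnm_sumE; apply: eq_bigr => i _; exact: mulmnE.
have sum5 (f : 'I_5 -> nat) : (\sum_(i < 5) f i = f (inord 0) + f (inord 1) + f (inord 2)
    + f (inord 3) + f (inord 4))%N.
  rewrite !big_ord_recl big_ord0 addn0 !addnA.
  by congr (f _ + f _ + f _ + f _ + f _)%N; apply/val_inj; rewrite /= inordK.
rewrite !lead_expI !sum5 /generator_lead !inordK //= !mulmnE !mnm1E -!val_eqE /= !inordK //=.
by rewrite !mul0n !mul1n !addn0 !add0n.
Qed.

(** The exponents of $x$ and $z$ give [I 0] and [I 4]. The exponent of $y$ is [2 * I 3] modulo $p$,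
    which gives [I 3]; dividing what remains by $p$ and reducing again gives [I 1], then [I 2]. *)
Lemma lead_exp_inj (I J : 'X_{1..5}) : (I (inord 1) < p)%N -> (I (inord 3) < p)%N ->
  (J (inord 1) < p)%N -> (J (inord 3) < p)%N -> lead_exp I = lead_exp J -> I = J.
Proof.
move=> I1 I3 J1 J3 eq_exp; have [] := lead_expE I; rewrite eq_exp; have [-> -> ->] := lead_expE J.
have p_gt0 := prime_gt0 p_prime.
move=> e0 e1 e2; have p3_gt0 : (0 < p ^ 3)%N by rewrite expn_gt0 p_gt0.
have e4 : J (inord 4) = I (inord 4) by apply/eqP; rewrite -(eqn_pmul2l p3_gt0) e2.
(* The quotients of $2a$ and $2b$ by $p$ are 0 or 1; if they differed, $2a-2b=\pm p$ would be
   odd. *)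
have red2 a b : (a < p)%N -> (b < p)%N -> 2 * a = 2 * b %[mod p] -> a = b.
  have p_odd : odd p by case/even_prime: p_prime p_gt2 => [->|].
  have p_half := odd_double_half p; rewrite p_odd -muln2 in p_half.
  move=> lta ltb; have := divn_eq (2 * b) p; have := divn_eq (2 * a) p.
  have : (2 * a %/ p < 2)%N by rewrite ltn_divLR // ltn_pmul2l.
  have : (2 * b %/ p < 2)%N by rewrite ltn_divLR // ltn_pmul2l.
  by move: (_ %/ _)%N (_ %/ _)%N => [|[|//]] [|[|//]] _ _ + + eqm; rewrite eqm; lia.
have pp : (p ^ 2 = p * p)%N by rewrite mulnn.
have e3 : J (inord 3) = I (inord 3).
  apply: red2 => //.
  have red (K : 'X_{1..5}) : (2 * p * K (inord 1) + p ^ 2 * K (inord 2) + (p ^ 2 + 2) * K (inord 3)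
     = (2 * K (inord 1) + p * K (inord 2) + p * K (inord 3)) * p + 2 * K (inord 3))%N.
    by rewrite pp; ring.
  by move: e1; rewrite !red => /(congr1 (modn^~ p)); rewrite !modnMDl.
have e1' : (2 * J (inord 1) + p * J (inord 2) = 2 * I (inord 1) + p * I (inord 2))%N.
  apply/eqP; rewrite -(eqn_pmul2l p_gt0); apply/eqP.
  by move: e1; rewrite e3 => /addIn; rewrite pp; lia.
have e1'' : J (inord 1) = I (inord 1).
  apply: red2 => //; move/(congr1 (modn^~ p)): e1'.
  by rewrite ![(p * _)%N]mulnC ![(2 * _ + _)%N]addnC !modnMDl.
have e2' : J (inord 2) = I (inord 2).
  by apply/eqP; rewrite -(eqn_pmul2l p_gt0); apply/eqP; move: e1'; rewrite e1'' => /addnI.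
apply/mnmP => i; have -> : i = inord i by apply/val_inj; rewrite /= inordK.
by case: i => [[|[|[|[|[|]]]]]] //= _.
Qed.

Lemma normal_lead Q : normal Q -> Q != 0 ->
  exists2 I, Q@_I != 0 & is_lead (Q \mPo B) (lead_exp I) /\
    (Q \mPo B)@_(lead_exp I) = Q@_I * ('X_[I] \mPo B)@_(lead_exp I).
Proof.
move=> nQ; rewrite -msupp_eq0 => Q0.
have [|||I] := @is_lead_big_distinct F 3 _ (msupp Q) (fun I => Q@_I)
   (fun I => 'X_[I] \mPo B) lead_exp (msupp_uniq Q) Q0.
- by move=> I; rewrite mcoeff_msupp.
- move=> I _; exact: monomial_lead.
- move=> I J; rewrite !mcoeff_msupp => /nQ/andP[I1 I3] /nQ/andP[J1 J3].
  exact: lead_exp_inj.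
by rewrite mcoeff_msupp -comp_mpolyEX => QI leadI; exists I.
Qed.

Lemma normal_comp_eq0 Q : normal Q -> Q \mPo B = 0 -> Q = 0.
Proof.
move=> nQ Q0; apply/eqP; apply: contraTT (eqxx (0 : R)) => nz; rewrite -{1}Q0.
by have [I _ [/is_lead_neq0]] := normal_lead nQ nz.
Qed.

(** The part [Q0] without [T 0] is again normal, so if nonzero its value has a lead monomial free of
    $x$, which survives modulo $x$. *)
Lemma normal_mod_x Q : normal Q -> mod_x (Q \mPo B) = 0 ->
  exists2 Q', normal Q' & Q = T 0 * Q'.
Proof.
move=> nQ modQ.
pose Q0 : {mpoly F[5]} := \sum_(I <- msupp Q | I (inord 0) == 0%N) Q@_I *: 'X_[I].
pose Q' : {mpoly F[5]} :=
  \sum_(I <- msupp Q | I (inord 0) != 0%N) Q@_I *: 'X_[I - U_(inord 0)].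
have def_Q : Q = Q0 + T 0 * Q'.
  rewrite [LHS]mpolyE (bigID (fun I : 'X_{1..5} => I (inord 0) == 0%N)) /=.
  congr (_ + _); rewrite /Q' mulr_sumr; apply: eq_bigr => I I0.
  by rewrite -scalerAr -mpolyXD addmC submK // lep1mP.
have nQ' : normal Q'.
  rewrite /Q' big_seq_cond; apply: big_ind => [||I /andP[]]; first exact: normal0.
    by move=> ? ?; apply: normalD.
  rewrite mcoeff_msupp => /nQ/andP[I1 I3] _; apply: normalZ.
  by apply: normalXm; rewrite mnmBE (leq_ltn_trans (leq_subr _ _)).
have nQ0 : normal Q0.
  rewrite /Q0 big_seq_cond; apply: big_ind => [||I /andP[]]; first exact: normal0.
    by move=> ? ?; apply: normalD.
  by rewrite mcoeff_msupp => /nQ/andP[I1 I3] _; apply/normalZ/normalXm.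
exists Q' => //; suff Q00 : Q0 = 0 by rewrite def_Q Q00 add0r.
apply/eqP; apply: contraT => /(normal_lead nQ0)[I Q0I [[leadI _] _]].
have I0 : I (inord 0) = 0%N.
  apply/eqP; apply: contraTT Q0I => I0; rewrite negbK /Q0 raddf_sum big1 // => J J0 /=.
  by rewrite mcoeffZ mcoeffX; case: (J =P I) J0 I0 => [->->//|]; rewrite mulr0.
case/negP: leadI; have [mu0 _ _] := lead_expE I.
have := mod_x_coef (Q0 \mPo B) (lead_exp I); rewrite mu0 I0 eqxx => <-.
have -> : Q0 \mPo B = Q \mPo B - x * (Q' \mPo B).
  by rewrite {1}def_Q comp_mpolyD rmorphM /= comp_mpolyXU inordK //= addrK.
by rewrite rmorphB rmorphM /= modQ mod_x_x mul0r subr0 mcoeff0.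
Qed.

(** Starting from $x^Mq$, [normal_mod_x] cancels the factors $x$ one at a time while keeping the
    combination normal. *)
Lemma invariant_span q : G_invariant p c q -> exists2 Q, normal Q & q = Q \mPo B.
Proof.
move/(invariant_normal p_prime p_gt2 charF g123 g135) => [M [Q [nQ]]].
have x0 : x != 0 by rewrite -msize_poly_eq0 msizeX.
elim: M Q nQ => [|M IHM] Q nQ eqQ; first by exists Q => //; rewrite -eqQ expr0 mul1r.
have [|Q' nQ' def_Q] := normal_mod_x nQ.
  by rewrite -eqQ exprS !rmorphM /= mod_x_x !mul0r.
apply: (IHM Q' nQ'); apply: (mulfI x0); rewrite mulrA -exprS eqQ def_Q rmorphM /=.
by rewrite comp_mpolyXU inordK.
Qed.

End NormalForms.

(** * Subduction and relations *)

Section Subduction.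
Variables (F : fieldType) (n k : nat) (b : k.-tuple {mpoly F[n]}).
Implicit Types (q r : {mpoly F[n]}) (P : {mpoly F[k]}).

Lemma subducts_to0_comp q P : subducts_to0 b q P -> q = P \mPo b.
Proof.
elim=> [|{}q a I {}P _ _ _ IH]; first by rewrite comp_mpoly0.
by rewrite comp_mpolyD comp_mpolyZ -IH addrC subrK.
Qed.

Lemma lead_term_eq q r : q != 0 -> lead_term r = lead_term q ->
  r != 0 /\ lead_mon r = lead_mon q.
Proof.
move=> q0 eqt; have [qm _] := lead_monP q0.
have := congr1 (mcoeff (lead_mon q)) eqt.
rewrite /lead_term !mcoeffZ !mcoeffX eqxx mulr1.
case: (_ =P _) => [eqm|_] eqc; last by rewrite -eqc mulr0 eqxx in qm.
split=> //; apply: contraNneq qm => r0.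
by rewrite -eqc r0 mcoeff0 mul0r.
Qed.

Lemma lead_term_is_lead q r m : is_lead q m -> is_lead r m -> q@_m = r@_m ->
  lead_term q = lead_term r.
Proof. by move=> /is_leadE qm /is_leadE rm eqm; rewrite /lead_term qm rm eqm. Qed.

Lemma is_leadZ a q m : a != 0 -> is_lead q m -> is_lead (a *: q) m.
Proof.
by move=> a0 [qm bnd]; split; [rewrite mcoeffZ mulf_neq0|apply: boundedZ].
Qed.

End Subduction.

Section Main.
Variables (p : nat) (F : fieldType) (c : 'M[F]_(2, 3)).
Hypotheses (p_prime : prime p) (p_gt2 : (2 < p)%N) (charF : p \in [pchar F]).
Hypotheses (g123 : gamma p c 1 2 3 != 0) (g135 : gamma p c 1 3 5 != 0).

Local Notation x := ('X_(inord 0) : {mpoly F[3]}).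
Local Notation gam := (gamma p c).

Local Notation B := (generators p c).
Local Notation T i := ('X_(inord i) : {mpoly F[5]}).
Local Notation normal := (normal p).
Local Notation mod_x := (@mod_x F).
Local Notation lead_exp := (lead_exp p).

Lemma comp_invariant Q : G_invariant p c (Q \mPo B).
Proof.
move=> g; rewrite group_actE /translate comp_mpolyA; congr (_ \mPo _).
apply: eq_from_tnth => i; rewrite tnth_map -[LHS](group_actE c g).
exact: generator_invariant.
Qed.

Lemma lead_monomials_comp I :
  'X_[I] \mPo [tuple 'X_[F, lead_mon (tnth B i)] | i < 5] = 'X_[lead_exp I].
Proof.
rewrite comp_mpolyX; under eq_bigr => i _ do
  rewrite tnth_mktuple (is_leadE (generators_lead p_prime p_gt2 charF g123 g135 i)).
by rewrite mprodXnE.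
Qed.

Lemma invariant_lead_mon q : G_invariant p c q -> q != 0 -> exists I, lead_mon q = lead_exp I.
Proof.
move/(invariant_span p_prime p_gt2 charF g123 g135) => [Q nQ ->] nz.
have [|I _ [leadI _]] := normal_lead p_prime p_gt2 charF g123 g135 nQ.
  by apply: contraNneq nz => ->; rewrite comp_mpoly0.
by exists I; apply: is_leadE.
Qed.

Lemma generators_sagbi : sagbi_basis (G_invariant p c) B.
Proof.
split=> [i|q]; first exact: generator_invariant.
split=> [[P ->]|[s [inv_s ->]]].
  (* The lead monomial of a product of generators is the product of their lead monomials, so each
     monomial of [P] is witnessed by the same product of generators. *)
  exists (map (fun I => (P@_I, 'X_[I] \mPo B)) (msupp P)); split.
    move=> _ /mapP[I _ ->]; split; first exact: comp_invariant.
    exact: is_lead_neq0 (monomial_lead p_prime p_gt2 charF g123 g135 I).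
  rewrite big_map comp_mpolyEX; apply: eq_bigr => I _ /=.
  by rewrite lead_monomials_comp (is_leadE (monomial_lead p_prime p_gt2 charF g123 g135 I)).
elim: s inv_s => [|u s IHs] inv_s; first by exists 0; rewrite big_nil comp_mpoly0.
have [|P eqP] := IHs; first by move=> v v_s; apply: inv_s; rewrite inE v_s orbT.
have [invu u0] := inv_s u (mem_head _ _); have [I eqI] := invariant_lead_mon invu u0.
exists (u.1 *: 'X_[I] + P).
by rewrite big_cons eqP comp_mpolyD comp_mpolyZ lead_monomials_comp eqI.
Qed.

(** Each step removes the monomial of [Q] that carries the lead term; the rest is still normal and
    has fewer monomials. *)
Lemma normal_subducts Q : normal Q -> subducts_to0 B (Q \mPo B) Q.
Proof.
have [n] := ubnP (size (msupp Q)); elim: n Q => // n IHn Q /ltnSE-szQ nQ.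
have [->|Q0] := eqVneq Q 0; first by rewrite comp_mpoly0; apply: SubductsDone.
have [I QI [leadI eqI]] := normal_lead p_prime p_gt2 charF g123 g135 nQ Q0.
rewrite -[X in subducts_to0 _ _ X](subrK (Q@_I *: 'X_[I])) addrC.
apply: SubductsStep; first exact: is_lead_neq0 leadI.
  apply: lead_term_is_lead leadI _; last by rewrite mcoeffZ.
  exact/is_leadZ/monomial_lead.
rewrite -comp_mpolyZ -comp_mpolyB; apply: IHn.
  rewrite (perm_size (msupp_rem _ _)) size_rem ?mcoeff_msupp //.
  by apply: leq_trans szQ; rewrite prednK // lt0n size_eq0 msupp_eq0.
apply: normalD => //; rewrite -scaleNr; apply: normalZ.
by have /andP[I1 I3] := nQ I QI; apply: normalXm.
Qed.

(** For an arbitrary subduction: the current polynomial is divisible by $x$, hence so is its lead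
    monomial. The subtracted product has that lead monomial, so it contains the generator $x$, and
    divisibility persists; degrees do not grow. *)
Lemma subducts_support q P d : degree_le q d -> mod_x q = 0 -> subducts_to0 B q P ->
  forall I, P@_I != 0 -> (0 < I (inord 0))%N && (mdeg (lead_exp I) <= d)%N.
Proof.
move=> + + sub; elim: sub => [|{}q a J {}P q0 eqt _ IH] dq modq I.
  by rewrite mcoeff0 eqxx.
have [aJ0 eqm] := lead_term_eq q0 eqt.
have a0 : a != 0 by apply: contraNneq aJ0 => ->; rewrite scale0r.
have leadJ := is_leadZ a0 (monomial_lead p_prime p_gt2 charF g123 g135 J).
have [qm _] := lead_monP q0; rewrite -eqm (is_leadE leadJ) in qm.
have [mu0 _ _] := lead_expE p J.
have J0 : (0 < J (inord 0))%N.
  rewrite lt0n; apply: contraNneq qm => J0; have := mod_x_coef q (lead_exp J).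
  by rewrite mu0 J0 eqxx modq mcoeff0 => <-.
have dJ : (mdeg (lead_exp J) <= d)%N by exact: dq.
rewrite mcoeffD mcoeffZ mcoeffX.
have [->|] := eqVneq P@_I 0; last first.
  move=> PI _; apply: IH PI.
    apply: degree_leD => //; rewrite -scaleNr; apply: degree_leZ => m Jm.
    by apply: leq_trans dJ; apply: grevlex_le_mdeg; case: (monomial_lead p_prime p_gt2 charF g123 g135 J) => _; apply.
  rewrite rmorphB /= modq mod_xZ (_ : mod_x ('X_[J] \mPo B) = 0) ?scaler0 ?subr0 //.
  have -> : J = (U_(inord 0) + (J - U_(inord 0)))%MM by rewrite addmC submK // lep1mP -lt0n.
  by rewrite mpolyXD !rmorphM /= comp_mpolyXU inordK //= mod_x_x mul0r.
by rewrite addr0; case: (J =P I) => [<- _|_]; rewrite ?J0 // mulr0 eqxx.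
Qed.

Lemma expression_comp : subducted_expression p c \mPo B =
  f3 p c ^+ p + (gam 1 3 5 ^+ p * gam 1 2 3 ^+ (p ^ 2 - 2 * p - 1)) *: (f1 p c * f2 p c ^+ p).
Proof.
rewrite /subducted_expression comp_mpolyD comp_mpolyZ rmorphM !rmorphXn /=.
by rewrite !comp_mpolyXU !inordK.
Qed.

Lemma expression_degree : degree_le (subducted_expression p c \mPo B) (p ^ 3 + 2 * p).
Proof.
have pp : (p ^ 3 = p ^ 2 * p)%N by rewrite -expnSr.
rewrite expression_comp; apply: degree_leD.
  have -> : (p ^ 3 + 2 * p = (p ^ 2 + 2) * p)%N by rewrite pp mulnDl.
  by apply: degree_leXn; exact: f3_degree.
apply: degree_leZ; rewrite addnC pp; apply: degree_leM; first exact: f1_degree.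
by apply: degree_leXn; exact: f2_degree.
Qed.

(** Modulo $x$ both summands are multiples of $y^{p^3+2p}$; the coefficient
    $\gamma_{135}^p\gamma_{123}^{p^2-2p-1}$ is chosen to make them cancel. *)
Lemma expression_mod_x : mod_x (subducted_expression p c \mPo B) = 0.
Proof.
have lt2p := p2_gt2p p_gt2; have p_gt0 := prime_gt0 p_prime.
rewrite expression_comp rmorphD /= mod_xZ rmorphM !rmorphXn /=.
rewrite mod_x_f1 // mod_x_f2 // mod_x_f3 // !exprZn -!exprM.
rewrite -scalerAl -scalerAr -exprD !scalerA.
have -> : (2 * p + p ^ 2 * p = (p ^ 2 + 2) * p)%N by rewrite mulnDl addnC.
rewrite -scalerDl; apply/eqP; rewrite scaler_eq0; apply/orP; left.
rewrite exprMn -exprM mulrN mulNr subr_eq0 mulrC -!mulrA; apply/eqP; congr (_ * _).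
rewrite -exprS -exprD; congr (_ ^+ _); rewrite mulnBl mul1n mulnn; lia.
Qed.

Lemma second_relation_comp : second_relation p c \mPo B = 0.
Proof.
have [_ [_ eqn]] := f3E c p_gt2 p_prime charF.
transitivity (f3_numerator p c + 2 *: (x ^+ (p ^ 2 - 2) * f3 p c)).
  rewrite /second_relation /f3_numerator !comp_mpolyD !comp_mpolyZ !rmorphM !rmorphXn /=.
  by rewrite !comp_mpolyXU !inordK.
by rewrite eqn -scalerDl addrC subrr scale0r.
Qed.

(** * Reduction to normal form modulo the two relations *)

Section Relations.
Variable P : {mpoly F[5]}.
Hypothesis P_support :
  forall I, P@_I != 0 -> (0 < I (inord 0))%N && (mdeg (lead_exp I) <= p ^ 3 + 2 * p)%N.

Local Notation r1 := (subducted_expression p c - P).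
Local Notation r2 := (second_relation p c).

Definition in_ideal (Q : {mpoly F[5]}) := exists Q1 Q2, Q = Q1 * r1 + Q2 * r2.

Lemma in_idealD Q Q' : in_ideal Q -> in_ideal Q' -> in_ideal (Q + Q').
Proof.
by case=> A [C ->] [A' [C' ->]]; exists (A + A'), (C + C'); rewrite !mulrDl addrACA.
Qed.

Lemma in_idealM A Q : in_ideal Q -> in_ideal (A * Q).
Proof. by case=> A1 [C ->]; exists (A * A1), (A * C); rewrite mulrDr !mulrA. Qed.

Definition reducible Q := exists2 Q', normal Q' & in_ideal (Q - Q').

Lemma reducible_normal Q : normal Q -> reducible Q.
Proof. by move=> nQ; exists Q => //; exists 0, 0; rewrite subrr !mul0r addr0. Qed.

Lemma reducibleD Q Q' : reducible Q -> reducible Q' -> reducible (Q + Q').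
Proof.
case=> N nN iN [N' nN' iN']; exists (N + N'); first exact: normalD.
by rewrite opprD addrACA; apply: in_idealD.
Qed.

Lemma reducibleZ a Q : reducible Q -> reducible (a *: Q).
Proof.
case=> N nN iN; exists (a *: N); first exact: normalZ.
by rewrite -scalerBr -mul_mpolyC; apply: in_idealM.
Qed.

Lemma reducible_ideal A Q : in_ideal A -> reducible Q -> reducible (A + Q).
Proof.
move=> iA [N nN iN]; exists N => //.
by rewrite -addrA; apply: in_idealD.
Qed.

(* The degree of 'X_[I] \mPo B, not counting the factors x. *)
Definition weight (I : 'X_{1..5}) : nat :=
  (2 * p * I (inord 1) + p ^ 2 * I (inord 2) + (p ^ 2 + 2) * I (inord 3)
   + p ^ 3 * I (inord 4))%N.

Lemma mdeg_lead_exp I : mdeg (lead_exp I) = (I (inord 0) + weight I)%N.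
Proof.
have [e0 e1 e2] := lead_expE p I.
have -> : mdeg (lead_exp I) = (lead_exp I (inord 0) + lead_exp I (inord 1) + lead_exp I (inord 2))%N.
  rewrite mdegE !big_ord_recl big_ord0 addn0 addnA.
  by congr (lead_exp I _ + lead_exp I _ + lead_exp I _)%N; apply/val_inj; rewrite /= inordK.
by rewrite e0 e1 e2 /weight !addnA.
Qed.

Lemma weightD I J : weight (I + J) = (weight I + weight J)%N.
Proof. by rewrite /weight !mnmDE; ring. Qed.

(* Lexicographic induction on (weight I, I_1 + I_3).  Rewriting T 1 ^+ p with r2
   or T 3 ^+ p with r1 produces one monomial of the same weight with a smaller
   I_1 + I_3, and monomials of smaller weight. *)
Lemma monomial_reducible I : reducible 'X_[I].
Proof.
have lt2p := p2_gt2p p_gt2; have p_gt0 := prime_gt0 p_prime.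
have pp : (p ^ 3 = p ^ 2 * p)%N by rewrite -expnSr.
have pp2 : (p ^ 2 = p * p)%N by rewrite mulnn.
have [w] := ubnP (weight I); elim: w I => // w IHw I /ltnSE-wI.
have [s] := ubnP (I (inord 1) + I (inord 3))%N; elim: s I wI => // s IHs I wI /ltnSE-sI.
have weightU (i : nat) k : (i < 5)%N ->
    weight (U_(inord i) *+ k) = (nth 0 [:: 0; 2 * p; p ^ 2; p ^ 2 + 2; p ^ 3] i * k)%N.
  move=> lti; rewrite /weight !mulmnE !mnm1E -!val_eqE /= !inordK //.
  by case: i lti => [|[|[|[|[|]]]]] //= _; rewrite ?mul1n ?mul0n ?muln0 ?addn0 ?add0n.
have splitI (i : nat) : (i < 5)%N -> (p <= I (inord i))%N ->
    exists2 J, I = (J + U_(inord i) *+ p)%MM & 'X_[I] = 'X_[J] * T i ^+ p.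
  move=> lti leI; have eqI : I = (I - U_(inord i) *+ p + U_(inord i) *+ p)%MM.
    rewrite submK //; apply/mnm_lepP => j; rewrite mulmnE mnm1E.
    by case: eqP => [<-|_]; rewrite ?mul1n ?mul0n.
  by exists (I - U_(inord i) *+ p)%MM; rewrite // {1}eqI mpolyXD -mpolyXn.
have [I1|I1] := ltnP (I (inord 1)) p; last first.
  have [J eqI ->] := splitI 1%N isT I1.
  have wJ : weight I = (weight J + 2 * p * p)%N by rewrite eqI weightD weightU.
  have -> : 'X_[J] * T 1 ^+ p = 'X_[J] * r2
     + ((- gam 1 2 3 ^+ (p - 2)) *: 'X_[J + U_(inord 2) *+ 2]
     + ((- (2 * (- gam 1 2 3) ^+ ((p - 3) %/ 2) * gam 1 2 5)) *:
          'X_[J + (U_(inord 0) *+ (p ^ 2 - p) + U_(inord 1) *+ ((p + 1) %/ 2))]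
     + (- 2) *: 'X_[J + (U_(inord 0) *+ (p ^ 2 - 2) + U_(inord 3) *+ 1)])).
    rewrite !mpolyXD -!mpolyXn /second_relation -!mul_mpolyC.
    rewrite !rmorphN /=; move: (_%:MP) (_%:MP) (2%:MP) => a b d.
    by move: 'X_[J] (T 1 ^+ p) (T 1 ^+ _) (T 0 ^+ _) (T 0 ^+ _) => X u v r t; ring.
  apply: reducible_ideal; first by exists 0, 'X_[J]; rewrite mul0r add0r.
  have half : ((p + 1) %/ 2 < p)%N by rewrite ltn_divLR //; lia.
  apply: reducibleD; last apply: reducibleD; apply: reducibleZ.
  (* Since $2p\cdot p=2p^2$ the weight is unchanged, but $p$ factors $f_1$ are gone. The other two
     monomials trade weight for powers of $x$. *)
  - apply: IHs; first by rewrite weightD weightU //=; lia.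
    move: sI; rewrite eqI !mnmDE !mulmnE !mnm1E -!val_eqE /= !inordK //=; lia.
  - apply: IHw; rewrite !weightD !weightU //=.
    have : (2 * p * ((p + 1) %/ 2) < 2 * p * p)%N by rewrite ltn_pmul2l ?muln_gt0.
    lia.
  - apply: IHw; rewrite !weightD !weightU //=; lia.
have [I3|I3] := ltnP (I (inord 3)) p; first by apply/reducible_normal/normalXm.
have [J eqI ->] := splitI 3%N isT I3.
have wJ : weight I = (weight J + (p ^ 2 + 2) * p)%N by rewrite eqI weightD weightU.
set a := gam 1 3 5 ^+ p * gam 1 2 3 ^+ (p ^ 2 - 2 * p - 1).
have -> : 'X_[J] * T 3 ^+ p = 'X_[J] * r1
    + ((- a) *: 'X_[J + (U_(inord 1) *+ 1 + U_(inord 2) *+ p)] + 'X_[J] * P).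
  rewrite !mpolyXD -!mpolyXn /subducted_expression -/a -!mul_mpolyC !rmorphN /=.
  by move: ('X_[J]) (T 3 ^+ p) (_%:MP) (T 2 ^+ _) => X b d e; ring.
apply: reducible_ideal; first by exists 'X_[J], 0; rewrite mul0r addr0.
apply: reducibleD.
  (* Again equal weight, as $2p+p^2\cdot p=(p^2+2)p$, with $p$ factors $f_3$ replaced by a single
     $f_1$. *)
  apply/reducibleZ/IHs; first by rewrite !weightD !weightU //=; lia.
  move: sI; rewrite eqI !mnmDE !mulmnE !mnm1E -!val_eqE /= !inordK //=; lia.
rewrite [P]mpolyE mulr_sumr big_seq; apply: big_ind.
- by apply: reducible_normal; exact: normal0.
- exact: reducibleD.
(* The degree bound $p^3+2p$ is the weight of [T 3 ^+ p]. The factor $x$ counts in the degree but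
   not in the weight, so [K] weighs strictly less. *)
move=> K; rewrite mcoeff_msupp => /P_support/andP[K0]; rewrite mdeg_lead_exp => wK.
rewrite -scalerAr -mpolyXD; apply/reducibleZ/IHw; rewrite weightD; lia.
Qed.

Lemma all_reducible Q : reducible Q.
Proof.
rewrite [Q]mpolyE; apply: big_ind => [||I _].
- by apply: reducible_normal; exact: normal0.
- exact: reducibleD.
exact/reducibleZ/monomial_reducible.
Qed.

(** The normal form of a relation has value 0, hence is 0 by [normal_comp_eq0], and so the relation
    itself lies in the ideal. *)
Lemma relations_generated : r1 \mPo B = 0 -> relations_generated_by B r1 r2.
Proof.
move=> r1_0 Q; split=> [Q0|[Q1 [Q2 ->]]]; last first.
  by rewrite comp_mpolyD !rmorphM /= r1_0 second_relation_comp !mulr0 addr0.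
have [N nN [Q1 [Q2 eqQ]]] := all_reducible Q.
suff N0 : N = 0 by exists Q1, Q2; rewrite -eqQ N0 subr0.
apply: (normal_comp_eq0 p_prime p_gt2 charF g123 g135 nN).
have := congr1 (comp_mpoly B) eqQ.
rewrite comp_mpolyB Q0 comp_mpolyD !rmorphM /= r1_0 second_relation_comp !mulr0 addr0.
by rewrite sub0r => /eqP; rewrite oppr_eq0 => /eqP.
Qed.

End Relations.

End Main.

Theorem theorem8p5 (p : nat) (F : fieldType) (c : 'M[F]_(2, 3))
    (p_prime : prime p) (p_gt2 : (2 < p)%N) (charF : p \in [pchar F])
    (gamma123_neq0 : gamma p c 1 2 3 != 0)
    (gamma135_neq0 : gamma p c 1 3 5 != 0) :
  let B := generators p c in
  let E := subducted_expression p c in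
  [/\ sagbi_basis (G_invariant p c) B,
      exists P, subducts_to0 B (E \mPo B) P
    & forall P, subducts_to0 B (E \mPo B) P ->
        relations_generated_by B (E - P) (second_relation p c)].
Proof.
move=> B E; split; first exact: generators_sagbi.
  have [|Q nQ ->] := @invariant_span p F c p_prime p_gt2 charF gamma123_neq0 gamma135_neq0 (E \mPo B).
    exact: comp_invariant.
  by exists Q; apply: normal_subducts.
(* [P] comes from an arbitrary subduction and need not be normal; [subducts_support] provides all
   that the reduction asks of it. *)
move=> P sub; apply: relations_generated => //.
  apply: subducts_support sub => //; first exact: expression_degree.
  exact: expression_mod_x.
by rewrite comp_mpolyB -(subducts_to0_comp sub) subrr.
Qed.
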